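(* There exists a pseudo-spherical representation of $\widetilde T_0$. Moreover, every pseudo-spherical representation $\tau$ of $\widetilde T_0$ is $\mathcal{W}$-invariant, namely ${}^{\tilde w}\tau\cong\tau$ for all $\tilde w\in\mathcal{W}$.
   Context: $F$ is a finite extension of $\mathbb{Q}_2$ with ring of integers $\mathcal{O}$. $(-,-)$ is the quadratic Hilbert symbol of $F$. $G$ is the group of $F$-points of an almost simple simply-connected split (Chevalley) group with irreducible simply-laced root system $\Phi$ (relative to a split maximal torus $T$) of rank at least $2$, with simple roots $\Delta=\{\alpha_1,\dots,\alpha_r\}$. $x_\alpha(t)$ are the Chevalley generators, $w_\alpha(t)=x_\alpha(t)x_{-\alpha}(-t^{-1})x_\alpha(t)$, $h_\alpha(t)=w_\alpha(t)w_\alpha(-1)$. $\widetilde{G}$ is the unique nontrivial topological central extension $1\to\mu_2\to\widetilde{G}\xrightarrow{\mathrm{pr}}G\to1$; it is generated by $\mu_2$ and lifts $\tilde{x}_\alpha(t)$ of $x_\alpha(t)$ with relations $\tilde x_\alpha(t)\tilde x_\alpha(u)=\tilde x_\alpha(t+u)$; for $\alpha+\beta\ne0$, $[\tilde x_\alpha(t),\tilde x_\beta(u)]=\tilde x_{\alpha+\beta}(ctu)$ if $\alpha+\beta\in\Phi$ (with $c=c(\alpha,\beta)\in\{\pm1\}$ as in $G$) and $1$ otherwise; $\tilde h_\alpha(t)\tilde h_\alpha(u)=(t,u)\tilde h_\alpha(tu)$, where $\tilde w_\alpha(t)=\tilde x_\alpha(t)\tilde x_{-\alpha}(-t^{-1})\tilde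 x_\alpha(t)$, $\tilde h_\alpha(t)=\tilde w_\alpha(t)\tilde w_\alpha(-1)$. $T_0=\langle h_\alpha(u):u\in\mathcal{O}^\times,\alpha\in\Phi\rangle$ and $\widetilde T_0=\mathrm{pr}^{-1}(T_0)$. $R=\{a\in\mathcal{O}^\times:(a,b)=1\ \forall b\in\mathcal{O}^\times\}$ and $T_R=\langle h_\alpha(a):a\in R,\alpha\in\Phi\rangle$, regarded as a (normal) subgroup of $\widetilde{T}_0$ via the homomorphism $\prod_i h_{\alpha_i}(a_i)\mapsto\prod_i\tilde h_{\alpha_i}(a_i)$. A pseudo-spherical representation of $\widetilde{T}_0$ is an irreducible genuine representation (genuine: $-1\in\mu_2$ acts by $-1$) that is trivial on $T_R$. $\mathcal{W}=\langle\tilde w_\alpha(1):\alpha\in\Phi\rangle\subset\widetilde G$, which normalizes $\widetilde T_0$, and ${}^{\tilde w}\tau(t)=\tau(\tilde w^{-1}t\tilde w)$. *)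

(* Defs.v *)
From HB Require Import structures.
From mathcomp Require Import all_boot all_order all_algebra all_field.
From mathcomp Require Import all_classical all_reals all_analysis.
From mathcomp Require Import complex.

Set Implicit Arguments.
Unset Strict Implicit.
Unset Printing Implicit Defensive.

Import Order.TTheory GRing.Theory Num.Theory.

Local Open Scope classical_set_scope.
Local Open Scope ring_scope.

Definition padic_abs (R : realType) (p : nat) (q : rat) : R :=
  if q == 0 then 0
  else (p ^ logn p `|denq q|)%:R / (p ^ logn p `|numq q|)%:R.

(* Qp is the completion of the rationals for the p-adic absolute value; this
   determines (Qp, abs) up to a unique isometric isomorphism. *)
Record padic_completion (R : realType) (p : nat) (Qp : fieldType)
    (abs : Qp -> R) : Prop := {
  padic_abs_ge0 : forall x, 0 <= abs x;
  padic_abs_eq0 : forall x, abs x = 0 <-> x = 0;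
  padic_absM : forall x y, abs (x * y) = abs x * abs y;
  padic_absD : forall x y, abs (x + y) <= abs x + abs y;
  padic_abs_rat : forall q : rat, abs (ratr q) = padic_abs R p q;
  padic_dense : forall x (e : R), 0 < e -> exists q : rat, abs (x - ratr q) < e;
  padic_complete : forall u : nat -> Qp,
    (forall e : R, 0 < e -> exists N, forall m n,
       (N <= m)%N -> (N <= n)%N -> abs (u m - u n) < e) ->
    exists l, forall e : R, 0 < e -> exists N, forall n,
       (N <= n)%N -> abs (u n - l) < e }.

Section LocalField.
Variables (R : realType) (K : fieldType) (abs : K -> R) (F : fieldExtType K).

(* The integral closure in F of the valuation ring of K. *)
Definition integers : set F :=
  [set x | exists p : {poly K},
     [/\ p \is monic, forall i, abs p`_i <= 1 &
         root (map_poly (in_alg F) p) x]].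

Definition integer_units : set F :=
  [set x | [/\ x != 0, integers x & integers x^-1]].

Definition hilbert (a b : F) : int :=
  if `[< exists x y z : F,
           (x, y, z) != (0, 0, 0) /\ z ^+ 2 = a * x ^+ 2 + b * y ^+ 2 >]
  then 1 else -1.

Definition unit_radical : set F :=
  [set a | integer_units a /\ forall b, integer_units b -> hilbert a b = 1].

End LocalField.

Section RootSystem.
Variables (R : realType) (r : nat).
Local Notation E := 'rV[R]_r.
Implicit Types (a b : E) (Phi : seq E).

Definition dot a b : R := \sum_i a 0 i * b 0 i.

(* <b, a^vee> *)
Definition cartan b a : R := 2 * dot b a / dot a a.

Record root_system Phi : Prop := {
  root_span : <<Phi>>%VS = fullv;
  root_neq0 : 0 \notin Phi;
  root_refl : {in Phi &, forall a b, b - cartan b a *: a \in Phi};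
  root_int : {in Phi &, forall a b, exists m : int, cartan b a = m%:~R};
  root_reduced : forall a (k : R),
    a \in Phi -> k *: a \in Phi -> k = 1 \/ k = -1 }.

Definition root_irreducible Phi : Prop :=
  forall P : pred E,
    (exists2 a, a \in Phi & P a) -> (exists2 b, b \in Phi & ~~ P b) ->
    exists a b, [/\ a \in Phi, b \in Phi, P a, ~~ P b & dot a b != 0].

Definition simply_laced Phi : Prop :=
  {in Phi &, forall a b, dot a a = dot b b}.

Record simple_roots Phi (Delta : r.-tuple E) : Prop := {
  simple_root : {subset Delta <= Phi};
  simple_basis : basis_of fullv Delta;
  simple_pos_neg : forall b, b \in Phi -> exists m : 'I_r -> nat,
    b = \sum_i tnth Delta i *+ m i \/ b = - \sum_i tnth Delta i *+ m i }.

End RootSystem.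

HB.mixin Record isTopGroup G & Group G & Topological G := {
  mulg_continuous : continuous (fun z : G * G => (z.1 * z.2)%g);
  invg_continuous : continuous (fun z : G => (z^-1)%g)
}.

#[short(type="topGroupType")]
HB.structure Definition TopGroup :=
  {G of Group G & Topological G & isTopGroup G}.

Definition is_subgroup (G : groupType) (H : set G) : Prop :=
  H 1%g /\ forall g h, H g -> H h -> H (g * h^-1)%g.

Definition generated (G : groupType) (S : set G) : set G :=
  smallest (@is_subgroup G) S.

Section Chevalley.
Variables (V : zmodType) (F : fieldType) (G : groupType) (x : V -> F -> G).

Definition chev_w (a : V) (t : F) : G :=
  (x a t * x (- a)%R (- t^-1)%R * x a t)%g.

Definition chev_h (a : V) (t : F) : G := (chev_w a t * chev_w a (-1)%R)%g.

End Chevalley.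

(* Following Steinberg, the group of F-points of the simply connected split
   group of type Phi is realised inside GL_n(F) as the group generated by the
   exponentials of the root vectors E_a of a Chevalley basis, acting on a
   representation F^n of the split Lie algebra whose weights span the whole
   weight lattice (this last condition is simple connectedness).  Over a field
   of characteristic 0 no choice of an admissible lattice is needed. *)
Section ChevalleyGroup.
Variables (R : realType) (r : nat) (Phi : seq 'rV[R]_r).
Variables (Delta : r.-tuple 'rV[R]_r) (F : fieldType) (n : nat).
Local Notation root := 'rV[R]_r.
Variables (c : root -> root -> int) (E : root -> 'M[F]_n).
Implicit Types a b : root.

Definition mxbracket (A B : 'M[F]_n) : 'M[F]_n := A *m B - B *m A.

Definition coroot_mx a : 'M[F]_n := mxbracket (E a) (E (- a)).

(* [H_a, E_b] = <b, a^vee> E_b, the Cartan integer being read in F.  Simplicity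
   of the Lie algebra and E_a != 0 make the representation faithful. *)
Record chevalley_basis : Prop := {
  chev_c : forall a b, a \in Phi -> b \in Phi -> a + b \in Phi ->
    c a b = 1 \/ c a b = -1;
  chev_neq0 : forall a, a \in Phi -> E a != 0;
  chev_bracket : forall a b, a \in Phi -> b \in Phi -> a + b \in Phi ->
    mxbracket (E a) (E b) = (c a b)%:~R *: E (a + b);
  chev_bracket0 : forall a b, a \in Phi -> b \in Phi ->
    a + b \notin Phi -> a + b != 0 -> mxbracket (E a) (E b) = 0;
  chev_coroot : forall a b (m : int), a \in Phi -> b \in Phi ->
    cartan b a = m%:~R -> mxbracket (coroot_mx a) (E b) = m%:~R *: E b }.

(* Weights, in the coordinates given by the fundamental weights. *)
Definition weight (m : 'rV[int]_r) : Prop :=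
  exists2 v : 'cV[F]_n, v != 0 &
    forall i, coroot_mx (tnth Delta i) *m v = (m 0 i)%:~R *: v.

Definition weights_span_lattice : Prop :=
  forall L : {pred 'rV[int]_r}, zmod_closed L ->
    (forall m, weight m -> m \in L) -> forall m, m \in L.

(* As [H_a, E_a] = 2 E_a, the matrix E_a is nilpotent in characteristic 0, and
   the exponential series stops before its n-th term. *)
Definition exp_mx (A : 'M[F]_n) : 'M[F]_n :=
  \sum_(k < n) (k`!%:R)^-1 *: A ^+ k.

Record chevalley_group (G : groupType) (x : root -> F -> G)
    (mat : G -> 'M[F]_n) : Prop := {
  mat_inj : injective mat;
  mat1 : mat 1%g = 1%:M;
  matM : forall g h, mat (g * h)%g = mat g *m mat h;
  mat_x : forall a t, a \in Phi -> mat (x a t) = exp_mx (t *: E a);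
  chev_gen :
    generated [set g | exists a t, a \in Phi /\ g = x a t] = [set: G] }.

End ChevalleyGroup.

(* The topology of G is induced by that of GL_n(F); the matrices congruent to 1
   modulo 2 ^ k form a basis of neighborhoods of 1 in the latter when F is a
   finite extension of K = Q_2. *)
Definition dyadic_topology (R : realType) (K : fieldType) (abs : K -> R)
    (F : fieldExtType K) (n : nat) (G : topGroupType) (mat : G -> 'M[F]_n) :
    Prop :=
  forall U : set G, nbhs (1%g : G) U <->
    exists k : nat,
      [set g | forall i j, exists2 o, integers abs o &
                 (mat g - 1%:M) i j = 2 ^+ k * o] `<=` U.

(* eps is the nontrivial element -1 of mu_2, which is {1, eps} in Gt. *)
Record topological_double_cover (G Gt : topGroupType)
    (pr : {multiplicative Gt -> G}) (eps : Gt) : Prop := {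
  cover_eps : eps != 1%g;
  cover_central : forall g, commute eps g;
  cover_ker : forall g, pr g = 1%g <-> g = 1%g \/ g = eps;
  cover_surj : forall g, exists gt, pr gt = g;
  cover_hausdorff : hausdorff_space Gt;
  cover_continuous : continuous pr;
  cover_open : forall U : set Gt, open U -> open (pr @` U) }.

Definition nontrivial_extension (G Gt : topGroupType)
    (pr : {multiplicative Gt -> G}) : Prop :=
  ~ exists s : {multiplicative G -> Gt}, continuous s /\ cancel s pr.

Definition mu2 (Gt : groupType) (eps : Gt) (s : int) : Gt :=
  if s == 1 then 1%g else eps.

Section DoubleCover.
Variables (R : realType) (r : nat) (Phi : seq 'rV[R]_r).
Variables (Delta : r.-tuple 'rV[R]_r).
Variables (K : fieldType) (abs : K -> R) (F : fieldExtType K).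
Local Notation root := 'rV[R]_r.
Variables (c : root -> root -> int) (G Gt : topGroupType).
Variables (x : root -> F -> G) (pr : {multiplicative Gt -> G}) (eps : Gt).
Variable xt : root -> F -> Gt.
Implicit Types a b : root.

Record cover_relations : Prop := {
  xt_lift : forall a t, a \in Phi -> pr (xt a t) = x a t;
  xt_gen : generated ([set eps] `|`
    [set g | exists a t, a \in Phi /\ g = xt a t]) = [set: Gt];
  xt_add : forall a t u, a \in Phi -> (xt a t * xt a u)%g = xt a (t + u);
  xt_comm : forall a b t u, a \in Phi -> b \in Phi -> a + b \in Phi ->
    [~ xt a t, xt b u]%g = xt (a + b) ((c a b)%:~R * t * u);
  xt_comm1 : forall a b t u, a \in Phi -> b \in Phi ->
    a + b != 0 -> a + b \notin Phi -> [~ xt a t, xt b u]%g = 1%g;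
  ht_mul : forall a t u, a \in Phi -> t != 0 -> u != 0 ->
    (chev_h xt a t * chev_h xt a u)%g =
    (mu2 eps (hilbert t u) * chev_h xt a (t * u))%g }.

Definition torus0 : set G :=
  generated [set g | exists a u,
    [/\ a \in Phi, integer_units abs u & g = chev_h x a u]].

Definition torus0_cover : set Gt := pr @^-1` torus0.

(* The image in Gt of T_R = { \prod_i h_{alpha_i}(a_i) : a_i in R } under
   \prod_i h_{alpha_i}(a_i) |-> \prod_i ht_{alpha_i}(a_i). *)
Definition torusR_lift : set Gt :=
  [set g | exists2 a : 'I_r -> F, forall i, unit_radical abs (a i) &
     g = (\prod_(i < r) chev_h xt (tnth Delta i) (a i))%g].

Definition weyl_lift : set Gt :=
  generated [set g | exists2 a, a \in Phi & g = chev_w xt a 1].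

End DoubleCover.

(* The values of tau outside of H are irrelevant.  Neither the dimension of V
   nor smoothness is imposed: T_R is open of finite index, so that an irreducible
   representation trivial on T_R is automatically finite-dimensional and
   smooth. *)
Section Representations.
Variables (R : realType) (Gt : groupType) (H : set Gt).

Definition representation (V : lmodType R[i]) (tau : Gt -> {linear V -> V}) :
    Prop :=
  (forall v, tau 1%g v = v) /\
  (forall g h, H g -> H h -> forall v, tau (g * h)%g v = tau g (tau h v)).

Definition irreducible_rep (V : lmodType R[i]) (tau : Gt -> {linear V -> V}) :
    Prop :=
  (exists v : V, v != 0) /\
  (forall U : {pred V}, submod_closed U ->
     (forall g v, H g -> v \in U -> tau g v \in U) ->
     (forall v, v \in U -> v = 0) \/ (forall v, v \in U)).

Definition isomorphic_rep (V W : lmodType R[i]) (tau : Gt -> {linear V -> V})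
    (sigma : Gt -> {linear W -> W}) : Prop :=
  exists2 phi : {linear V -> W}, bijective phi &
    forall g, H g -> forall v, phi (tau g v) = sigma g (phi v).

Definition conj_rep (V : lmodType R[i]) (w : Gt) (tau : Gt -> {linear V -> V}) :
    Gt -> {linear V -> V} := fun g => tau (w^-1 * g * w)%g.

(* N stands for T_R and eps for the element -1 of mu_2. *)
Record pseudo_spherical (N : set Gt) (eps : Gt) (V : lmodType R[i])
    (tau : Gt -> {linear V -> V}) : Prop := {
  ps_rep : representation tau;
  ps_irreducible : irreducible_rep tau;
  ps_genuine : forall v, tau eps v = - v;
  ps_trivial : forall g, N g -> forall v, tau g v = v }.

End Representations.

(* Main.v *)
Require Import Defs.
From HB Require Import structures.
From mathcomp Require Import all_boot all_order all_algebra all_field.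
From mathcomp Require Import all_classical all_reals all_analysis.
From mathcomp Require Import complex ring lra zify.

(** All computations take place in the cover, where the commutation relations
    of simply laced type yield, for a torus element g whose conjugation is
    x_a(u) |-> x_a(k u) on the root subgroup of a,
      g^-1 h_a(u) g = (u, k) h_a(u)   and
      w_a(1)^-1 g w_a(1) = (k, -1) g h_a(k).
    The first relation makes the Hilbert symbol bimultiplicative and the image
    of T_R central in the cover of T_0.

    Invariance: in a genuine representation trivial on T_R, the operators
    q(u) = tau(h_a(u)) depend only on u modulo R.  The group of units modulo R
    is finite, because 1 + 8 O consists of squares and O / 8 O is finite, and
    the Gauss sum phi = \sum_(u mod R) q(u) satisfies
      tau(w_a(1)^-1 g w_a(1)) phi = phi tau(g)   and   phi^2 = #(O^* / R) q(-1),
    so that phi is an isomorphism.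

    Existence: simple connectedness makes (a_i) |-> \prod_i h_i(a_i) injective,
    so that -1 is not in the image of T_R.  The genuine character of
    {1, -1} T_R trivial on T_R induces to a finite-dimensional representation,
    and any irreducible constituent of the latter is pseudo-spherical. *)

Set Implicit Arguments.
Unset Strict Implicit.
Unset Printing Implicit Defensive.

Import Order.TTheory GRing.Theory Num.Theory.

Local Open Scope ring_scope.

(** * The field Q_2 *)

(** Only generators and relations are given, so the properties of the torus and of the symbol are
    extracted from them. The commutator relations exclude the pair a, -a, hence do not say how
    h_a(t) moves x_a and x_{-a}; rank at least 2 supplies this, since a = b + d makes x_a a
    commutator of elements whose conjugates are known. The signs of the structure constants are
    unknown, so h_{a+b}(s) and h_b(s) h_a(s) are compared only up to (s, 1) or (s, -1). The
    ambiguity disappears for s in R and after projection to G, the two situations where roots are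
    reduced to simple roots. The Gauss sum is forced by the relations: q(k) q(u) = (k, u) q(ku)
    gives q(k) phi = (k, k) \sum_u (u, k) q(u). The symbols (u, k) are those met when tau(g) passes
    q(u), and (k, k) = (k, -1) cancels the sign of the conjugation. The value of phi^2 is
    orthogonality of characters, and it yields an explicit inverse in any dimension. For
    injectivity, the factor t^m by which h_a(t) acts on a weight vector is read off from a
    weight-by-weight expansion of three exponentials, with no decomposition of F^n into irreducible
    sl_2-modules. *)

Section DyadicAbs.
Variables (R : realType) (Q2 : fieldType) (abs : Q2 -> R).
Hypothesis hQ2 : padic_completion 2 abs.

Lemma abs1 : abs 1 = 1.
Proof.
have := padic_abs_rat hQ2 1%:~R; rewrite ratr_int => ->.
by rewrite /padic_abs oner_eq0 /= logn1 !expn0 divr1.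
Qed.

Lemma abs0 : abs 0 = 0.
Proof. exact/(padic_abs_eq0 hQ2). Qed.

Lemma absV x : abs x^-1 = (abs x)^-1.
Proof.
have [->|x0] := eqVneq x 0; first by rewrite invr0 abs0 invr0.
have ax0 : abs x != 0 by apply: contraNneq x0 => /(padic_abs_eq0 hQ2) ->.
by apply: (mulfI ax0); rewrite -(padic_absM hQ2) !divff ?abs1.
Qed.

Lemma absN1 : abs (-1) = 1.
Proof.
apply/eqP; rewrite -(@pexpr_eq1 _ (abs (-1)) 2) ?(padic_abs_ge0 hQ2) //.
by rewrite expr2 -(padic_absM hQ2) mulrNN mulr1 abs1.
Qed.

Lemma absN x : abs (- x) = abs x.
Proof. by rewrite -mulN1r (padic_absM hQ2) absN1 mul1r. Qed.

Lemma absX x n : abs (x ^+ n) = abs x ^+ n.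
Proof.
elim: n => [|n ih]; first by rewrite !expr0 abs1.
by rewrite !exprS (padic_absM hQ2) ih.
Qed.

Lemma abs_intr (m : int) : abs m%:~R = padic_abs R 2 m%:~R.
Proof. by rewrite -(padic_abs_rat hQ2) ratr_int. Qed.

Lemma abs_int_le1 (m : int) : abs m%:~R <= 1.
Proof.
rewrite abs_intr /padic_abs; case: eqP => // _.
rewrite numq_int denq_int logn1 expn0 div1r invf_le1 ?ltr0n ?expn_gt0 //.
by rewrite ler1n expn_gt0.
Qed.

Lemma abs2 : abs 2 = 2^-1.
Proof.
have -> : (2 : Q2) = 2%:~R by [].
by rewrite abs_intr /padic_abs intr_eq0 numq_int denq_int /= logn1 lognE /=
  expn1 div1r.
Qed.

Lemma two_neq0 : (2 : Q2) != 0.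
Proof.
apply/eqP => /(padic_abs_eq0 hQ2); rewrite abs2 => /eqP.
by rewrite invr_eq0 pnatr_eq0.
Qed.

Lemma bernoulli (d : R) n : 0 <= d -> 1 + n%:R * d <= (1 + d) ^+ n.
Proof.
move=> d0; elim: n => [|n ih]; first by rewrite expr0 mul0r addr0.
rewrite exprS.
have : (1 + d) * (1 + n%:R * d) <= (1 + d) * (1 + d) ^+ n.
  by rewrite ler_wpM2l ?addr_ge0.
apply: le_trans; rewrite -natr1.
have : 0 <= n%:R * d * d by rewrite !mulr_ge0.
nra.
Qed.

(** Bernoulli applied to a ^ m and then squared makes a ^ (2 m) grow quadratically in m when a > 1;
    [m] is taken with m (a - 1)^2 > 2. *)
Lemma powers_linear_le1 (a : R) : 0 <= a -> (forall n, a ^+ n <= n.+1%:R) ->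
  a <= 1.
Proof.
move=> a0 h; rewrite leNgt; apply/negP => a1.
have d0 : 0 < a - 1 by rewrite subr_gt0.
set d := a - 1 in d0; have ad : a = 1 + d by rewrite /d; ring.
have [m hm] : exists m : nat, 2 / (d * d) < m%:R.
  exists (Num.bound (2 / (d * d))); apply: archi_boundP.
  by rewrite divr_ge0 // mulr_ge0 // ltW.
have dd0 : 0 < d * d by rewrite mulr_gt0.
have hm2 : 2 < m%:R * (d * d) by rewrite -ltr_pdivrMr.
have := h (m * 2)%N; rewrite exprM => hle.
have hb := bernoulli m (ltW d0); rewrite -ad in hb.
have md0 : 0 <= m%:R * d by rewrite mulr_ge0 // ltW.
have : (1 + m%:R * d) ^+ 2 <= (a ^+ m) ^+ 2.
  by rewrite ler_pXn2r // nnegrE ?addr_ge0 ?exprn_ge0.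
move/le_trans => /(_ _ hle); rewrite -natr1 natrM.
have m0 : 0 <= (m%:R : R) by [].
have : 2 * m%:R <= m%:R * (m%:R * (d * d)) by rewrite mulrC ler_wpM2l // ltW.
have [m1|] := ltnP 0 m; last first.
  by rewrite leqn0 => /eqP m00; move: hm2; rewrite m00 mul0r ltNge ler0n.
have : 1 <= (m%:R : R) by rewrite ler1n.
nra.
Qed.

(** Only the triangle inequality is given. Integers have absolute value at most 1, so the binomial
    expansion bounds the n-th power of abs (1 + x) by n + 1, and a base above 1 would grow
    faster. *)
Lemma abs_add1_le1 x : abs x <= 1 -> abs (1 + x) <= 1.
Proof.
move=> x1; apply: powers_linear_le1 => [|n]; first exact: (padic_abs_ge0 hQ2).
rewrite -absX exprDn.
have abs_sum (m : nat) (f : 'I_m -> Q2) : abs (\sum_i f i) <= \sum_i abs (f i).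
  apply: (big_ind2 (fun a b => abs a <= b)); rewrite ?abs0 // => a b c d ab cd.
  by apply: le_trans (padic_absD hQ2 _ _) _; apply: lerD.
apply: le_trans (abs_sum _ _) _.
have -> : n.+1%:R = \sum_(i < n.+1) (1 : R) by rewrite sumr_const card_ord.
apply: ler_sum => i _; rewrite expr1n mul1r -mulr_natr.
rewrite (padic_absM hQ2) absX mulr_ile1 ?exprn_ge0 ?exprn_ile1
  ?(padic_abs_ge0 hQ2) //.
by rewrite pmulrn abs_int_le1.
Qed.

Lemma abs_ultra x y (e : R) : abs x <= e -> abs y <= e -> abs (x + y) <= e.
Proof.
wlog xy : x y / abs x <= abs y.
  move=> hw hx hy; have /orP[h|h] := le_total (abs x) (abs y); first exact: hw.
  by rewrite addrC hw.
move=> _ ye; apply: le_trans ye.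
have [y0|y0] := eqVneq y 0.
  move: xy; rewrite y0 abs0 => x0; rewrite addr0 //.
have ay0 : 0 < abs y.
  rewrite lt_neqAle (padic_abs_ge0 hQ2) andbT eq_sym.
  by apply: contraNneq y0 => /(padic_abs_eq0 hQ2) ->.
have -> : x + y = y * (1 + x / y) by rewrite mulrDr mulr1 mulrC divfK // addrC.
rewrite (padic_absM hQ2) ger_pMr // abs_add1_le1 //.
by rewrite (padic_absM hQ2) absV ler_pdivrMr ?mul1r.
Qed.

Lemma abs_int_neq0 (m : int) : m != 0 -> abs m%:~R != 0.
Proof.
move=> m0; rewrite abs_intr /padic_abs intr_eq0 (negbTE m0) numq_int denq_int.
by rewrite mulf_neq0 ?invr_neq0 // pnatr_eq0 -lt0n expn_gt0.
Qed.

Lemma abs_even (m : int) : (2 %| m)%Z -> abs m%:~R <= 2^-1.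
Proof.
move=> /dvdzP[k ->]; rewrite intrM (padic_absM hQ2) abs2.
by rewrite ger_pMl ?invr_gt0 ?ltr0n // abs_int_le1.
Qed.

Lemma abs_odd (m : int) : ~~ (2 %| m)%Z -> abs m%:~R = 1.
Proof.
move=> m2; rewrite abs_intr /padic_abs intr_eq0 ifN; last first.
  by apply: contraNneq m2 => ->.
rewrite numq_int denq_int logn1 expn0 div1r lognE.
by rewrite -[(2 %| `|m|)%N]/((2 %| m)%Z) (negbTE m2) !andbF expn0 invr1.
Qed.

(** By density x is within 1/2 of a rational number; the denominator of the latter is odd, and the
    parity of its numerator gives [b]. *)
Lemma residue_field_F2 x : abs x <= 1 ->
  exists b : bool, exists2 y, abs y <= 1 & x = b%:R + 2 * y.
Proof.
have half0 : 0 < 2^-1 :> R by rewrite invr_gt0.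
have half1 : 2^-1 <= 1 :> R by rewrite invf_le1 ?ler1n.
have red (b : bool) z : abs (z - b%:R) <= 2^-1 ->
    exists b : bool, exists2 y, abs y <= 1 & z = b%:R + 2 * y.
  move=> hz; exists b; exists ((z - b%:R) / 2); last first.
    by rewrite mulrCA divff ?two_neq0 // mulr1 addrC subrK.
  by rewrite (padic_absM hQ2) absV abs2 invrK -ler_pdivlMr // mul1r.
move=> x1; have [q hq] := padic_dense hQ2 x half0.
suff [b hb] : exists b : bool, abs (ratr q - b%:R) <= 2^-1.
  by apply: (red b); rewrite -(subrKA (ratr q)) abs_ultra // ltW.
have q1 : abs (ratr q) <= 1.
  rewrite -[ratr q](subrK x) abs_ultra // -absN opprB (le_trans (ltW hq)) //.
have ratq : (ratr q : Q2) = (numq q)%:~R / (denq q)%:~R by [].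
(* In lowest terms an even denominator comes with an odd numerator, and the absolute value would be
   at least 2. *)
have dodd : ~~ (2 %| denq q)%Z.
  apply: contraTN q1 => d2; rewrite -ltNge ratq (padic_absM hQ2) absV.
  rewrite abs_odd ?mul1r; last first.
    apply: contraTN (coprime_num_den q) => n2.
    apply/negP => /eqP co.
    have : (2 %| gcdn `|numq q| `|denq q|)%N by rewrite dvdn_gcd; apply/andP;
      split.
    by rewrite co.
  rewrite invf_gt1; first by apply: le_lt_trans (abs_even d2) _;
    rewrite invf_lt1 ?ltr1n.
  rewrite lt_neqAle (padic_abs_ge0 hQ2) andbT eq_sym.
  by rewrite abs_int_neq0 // denq_eq0.
have dq0 : (denq q)%:~R != 0 :> Q2.
  by apply/eqP => d0; have := abs_odd dodd; rewrite d0 abs0 => /eqP;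
    rewrite eq_sym oner_eq0.
have [n2|n2] := boolP (2 %| numq q)%Z.
  by exists false; rewrite subr0 ratq (padic_absM hQ2) absV (abs_odd dodd) invr1
    mulr1 abs_even.
exists true; have -> : ratr q - true%:R =
  (numq q - denq q)%:~R / (denq q)%:~R :> Q2.
  by rewrite ratq intrB mulrBl divff.
rewrite (padic_absM hQ2) absV (abs_odd dodd) invr1 mulr1 abs_even //.
lia.
Qed.

End DyadicAbs.

(* The proof argument only serves to make the ring structure of Z2 canonical. *)
Definition dyadic_int (R : realType) (Q2 : fieldType) (abs : Q2 -> R)
  (hQ2 : padic_completion 2 abs) : {pred Q2} := [pred x | abs x <= 1].

Fact dyadic_int_subring (R : realType) (Q2 : fieldType) (abs : Q2 -> R)
  (hQ2 : padic_completion 2 abs) : subring_closed (dyadic_int hQ2).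
Proof.
split=> [|x y|x y]; rewrite !inE ?abs1 //.
  by move=> x1 y1; apply: (abs_ultra hQ2); rewrite ?(absN hQ2).
by move=> x1 y1; rewrite (padic_absM hQ2) mulr_ile1 ?(padic_abs_ge0 hQ2).
Qed.

HB.instance Definition _ (R : realType) (Q2 : fieldType) (abs : Q2 -> R)
  (hQ2 : padic_completion 2 abs) :=
  GRing.isSubringClosed.Build Q2 (dyadic_int hQ2) (dyadic_int_subring hQ2).

Definition Z2 (R : realType) (Q2 : fieldType) (abs : Q2 -> R)
  (hQ2 : padic_completion 2 abs) := {x | x \in dyadic_int hQ2}.

HB.instance Definition _ (R : realType) (Q2 : fieldType) (abs : Q2 -> R)
  (hQ2 : padic_completion 2 abs) := SubChoice.on (Z2 hQ2).
HB.instance Definition _ (R : realType) (Q2 : fieldType) (abs : Q2 -> R)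
  (hQ2 : padic_completion 2 abs) :=
  [SubChoice_isSubComNzRing of Z2 hQ2 by <:].

(** * Completeness of Z_2 in terms of divisibility, and a fixed point *)

Section DyadicIntegers.
Variables (R : realType) (Q2 : fieldType) (abs : Q2 -> R).
Hypothesis hQ2 : padic_completion 2 abs.
Local Notation Z := (Z2 hQ2).

Lemma abs_val (u : Z) : abs (val u) <= 1.
Proof. exact: (valP u). Qed.

Lemma dyadic_geometric n : abs (2 ^+ n) = 2^-1 ^+ n.
Proof. by rewrite (absX hQ2) (abs2 hQ2). Qed.

Lemma dvd_pow2 (u : Z) n : abs (val u) <= 2^-1 ^+ n -> exists e, u = 2 ^+ n * e.
Proof.
move=> un; have e1 : val u / 2 ^+ n \in dyadic_int hQ2.
  rewrite inE (padic_absM hQ2) (absV hQ2) dyadic_geometric.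
  by rewrite ler_pdivrMr ?mul1r // exprn_gt0 // invr_gt0.
exists (exist (fun x => x \in dyadic_int hQ2) _ e1 : Z); apply: val_inj;
  rewrite rmorphM rmorphXn rmorph_nat /=.
by rewrite mulrC divfK // expf_neq0 // (two_neq0 hQ2).
Qed.

Lemma abs_pow2_mul n (e : Z) : abs (val (2 ^+ n * e)) <= 2^-1 ^+ n.
Proof.
rewrite rmorphM rmorphXn rmorph_nat (padic_absM hQ2) dyadic_geometric.
by rewrite ger_pMr ?abs_val // exprn_gt0 // invr_gt0.
Qed.

Lemma pow2_divisible_eq0 (u : Z) : (forall n, exists e, u = 2 ^+ n * e) -> u =
  0.
Proof.
move=> h; apply/val_inj/(padic_abs_eq0 hQ2)/eqP.
rewrite eq_le (padic_abs_ge0 hQ2) andbT leNgt; apply/negP => u0.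
have [n] := @ltr_add_invr _ 0 (abs (val u)) u0.
rewrite add0r ltNge => /negP; apply; have [e ue] := h n.
rewrite {1}ue (le_trans (abs_pow2_mul n e)) // exprVn lef_pV2 ?posrE ?ltr0n
  ?exprn_gt0 //.
by rewrite -natrX ler_nat ltn_expl.
Qed.

(** Completeness expressed by congruences modulo powers of 2, so that it applies to polynomials
    coefficient by coefficient without estimates. *)
Lemma dyadic_limit (u : nat -> Z) :
  (forall n, exists e, u n.+1 - u n = 2 ^+ n * e) ->
  exists l, forall n, exists e, l - u n = 2 ^+ n * e.
Proof.
move=> du.
have close n d : abs (val (u (n + d)%N) - val (u n)) <= 2^-1 ^+ n.
  elim: d => [|d ih].
    by rewrite addn0 subrr (abs0 hQ2) exprn_ge0 // invr_ge0.
  rewrite -(subrKA (val (u (n + d)%N))) (abs_ultra hQ2) // addnS.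
  have [e he] := du (n + d)%N%N.
  rewrite -rmorphB he exprD -mulrA; exact: abs_pow2_mul.
have [|l hl] := @padic_complete _ _ _ _ hQ2 (fun n => val (u n)).
  move=> e e0; have [N] := @ltr_add_invr _ 0 e e0; rewrite add0r => hN.
  exists N => m n Nm Nn.
  apply: le_lt_trans hN; apply: (@le_trans _ _ (2^-1 ^+ N)); last first.
    by rewrite exprVn lef_pV2 ?posrE ?ltr0n ?exprn_gt0 // -natrX ler_nat
      ltn_expl.
  rewrite -(subrKA (val (u N))) (abs_ultra hQ2) //;
    first by rewrite -(subnKC Nm).
  by rewrite -(absN hQ2) opprB -(subnKC Nn).
have cl n : abs (l - val (u n)) <= 2^-1 ^+ n.
  have p0 : 0 < 2^-1 ^+ n :> R by rewrite exprn_gt0 // invr_gt0.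
  have [N hN] := hl _ p0.
  rewrite -(subrKA (val (u (n + N)%N))) (abs_ultra hQ2) //.
  by rewrite -(absN hQ2) opprB ltW // hN // leq_addl.
have l1 : l \in dyadic_int hQ2.
  rewrite inE -(subrK (val (u 0%N)) l); apply: (abs_ultra hQ2);
    last exact: abs_val.
  exact: (cl 0%N).
by exists (exist (fun x => x \in dyadic_int hQ2) _ l1 : Z) => n;
  apply: dvd_pow2; rewrite rmorphB; exact: cl.
Qed.

(* This solves z + 2 z^2 = b, and hence (1 + 4 z)^2 = 1 + 8 b, for b a root of
   p; the map z |-> X - 2 z^2 contracts the complete ring Z_2[X]/(p). *)
Lemma contraction_fixpoint (p : {poly Z}) : p \is monic ->
  exists q d : {poly Z}, 'X - 2 *: q ^+ 2 = d * p + q.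
Proof.
move=> mp; pose Phi (q : {poly Z}) := Pdiv.Ring.rmodp ('X - 2 *: q ^+ 2) p.
have Phi_contr n (q1 q2 e : {poly Z}) : q1 - q2 = 2 ^+ n *: e ->
    exists e', Phi q1 - Phi q2 = 2 ^+ n.+1 *: e'.
  move=> he; exists (Pdiv.Ring.rmodp (- (e * (q1 + q2))) p).
  rewrite /Phi -(Pdiv.RingMonic.rmodpB mp) -(Pdiv.RingMonic.rmodpZ mp).
  congr (Pdiv.Ring.rmodp _ _); rewrite opprB addrC addrA subrK -scalerBr.
  by rewrite -[q2 ^+ 2 - _]opprB subr_sqr he -scalerAl exprS -scalerA !scalerN.
pose q := fix q n := if n is n'.+1 then Phi (q n') else 0.
have p0 : p != 0 by rewrite monic_neq0.
have dq n : exists e, q n.+1 - q n = 2 ^+ n *: e.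
  elim: n => [|n [e he]]; last exact: Phi_contr he.
  by exists (q 1%N - q 0%N); rewrite expr0 scale1r.
(* Bounded size leaves finitely many coefficients, whose limits assemble into a polynomial [Q]. *)
have sq n : (size (q n) <= size p)%N.
  by case: n => [|n] /=; rewrite ?size_poly0 // ltnW // /Phi
    Pdiv.Ring.ltn_rmodp.
have /choice[l hl] : forall i, exists l, forall n, exists e, l - (q n)`_i =
  2 ^+ n * e.
  move=> i; apply: (@dyadic_limit (fun n => (q n)`_i)) => n.
  have [e he] := dq n.
  by exists e`_i; rewrite -coefZ -he coefB.
pose Q := \poly_(i < size p) l i.
have dQ n : exists e, Q - q n = 2 ^+ n *: e.
  have /choice[e he] : forall i, exists e, l i - (q n)`_i = 2 ^+ n * e.
    by move=> i; apply: hl.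
  exists (\poly_(i < size p) e i); apply/polyP => i.
  rewrite coefB coefZ !coef_poly; case: ltnP => // pi.
  by rewrite nth_default ?subr0 ?mulr0 // (leq_trans (sq n)).
(* The coefficients of [Q - Phi Q] are divisible by every power of 2, since both terms are close to
   the next iterate. *)
have fixQ : Q = Phi Q.
  apply/eqP; rewrite -subr_eq0; apply/eqP/polyP => i; rewrite coef0.
  apply: pow2_divisible_eq0 => n.
  have [e1 h1] := dQ n.+1; have [e2 h2] := dQ n.
  have [e3 h3] := Phi_contr _ _ _ _ h2.
  exists (2 * (e1 - e3))`_i.
  have -> : Q - Phi Q = 2 ^+ n *: (2 * (e1 - e3)).
    rewrite -(subrKA (q n.+1)) h1 -[q n.+1 - _]opprB [q n.+1]/(Phi (q n)) h3.
    by rewrite -scalerBr exprSr -scalerA; congr (_ *: _);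
      rewrite scaler_nat mulr_natl.
  by rewrite coefZ.
exists Q, (Pdiv.Ring.rdivp ('X - 2 *: Q ^+ 2) p).
by rewrite {1}(Pdiv.RingMonic.rdivp_eq mp ('X - 2 *: Q ^+ 2)) -/(Phi Q) -fixQ.
Qed.

End DyadicIntegers.

(** * Integers, units and the radical R of F *)

Section Transversal.
Variables (T S : Type) (H : T -> Prop) (e : T -> T -> Prop) (L : seq S).
Variable m : T -> S -> Prop.

(** A maximal family of inequivalent elements meets every class, and its size is bounded by the
    pigeonhole principle on the labels in [L]. It serves for the units modulo R, labelled by
    residues modulo 8, and for the cover of T_0 modulo mu_2 T_R. The default [s0] is quantified
    because [S] could be empty. *)
Lemma finite_transversal :
    (forall x y, e x y -> e y x) -> 
    (forall x, H x -> exists i : 'I_(size L), forall s0, m x (nth s0 L i)) ->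
    (forall x y s, H x -> H y -> m x s -> m y s -> e x y) ->
  exists N (t : 'I_N -> T), [/\ forall i, H (t i),
    forall i j, e (t i) (t j) -> i = j & forall x, H x -> exists i, e x (t i)].
Proof.
move=> esym cover eqv.
pose P N := exists t : 'I_N -> T,
  (forall i, H (t i)) /\ (forall i j, e (t i) (t j) -> i = j).
have P0 : exists N, `[< P N >].
  have t0 : 'I_0 -> T by case.
  by exists 0%N; apply/asboolP; exists t0; split=> -[].
have Pmax N : `[< P N >] -> (N <= size L)%N.
  move=> /asboolP[t [Ht t_inj]].
  have /choice[k hk] := fun i => cover _ (Ht i).
  have k_inj : injective k.
    move=> i j kij; apply: t_inj.
    have [s0] : inhabited S.
      by case: L (k i) => [[]//|s ?]; exists.
    by apply: eqv (Ht i) (Ht j) (hk i s0) _; rewrite kij; apply: hk.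
  by have := leq_card k k_inj; rewrite !card_ord.
case: (ex_maxnP P0 Pmax) => N /asboolP[t [Ht t_inj]] Nmax.
exists N, t; split=> // x Hx; apply: contrapT => nx.
suff /asboolP/Nmax : P N.+1 by rewrite ltnn.
exists (fun i => if unlift ord_max i is Some j then t j else x);
  split=> [i|i j].
  by case: unliftP.
case: unliftP => [i' ->|->]; case: unliftP => [j' ->|->] //.
- by move/t_inj ->.
- by move/esym => h; case: nx; exists i'.
- by move=> h; case: nx; exists j'.
Qed.

End Transversal.

Section Integers.
Variables (R : realType) (Q2 : fieldType) (abs : Q2 -> R).
Hypothesis hQ2 : padic_completion 2 abs.
Variable F : fieldExtType Q2.
Local Notation Z := (Z2 hQ2).
Local Notation O := (@integers R Q2 abs F).
Local Notation U := (@integer_units R Q2 abs F).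
Let vz : {rmorphism Z -> Q2} := (val : Z -> Q2).
Let f : {rmorphism Z -> F} := in_alg F \o vz.

(** Moves the coefficients of the monic equation into the ring [Z2], where the closure properties of
    integral elements over a ring apply. *)
Lemma integersP (x : F) : O x <-> integralOver f x.
Proof.
split=> [[p [mp p1 px]]|[q mq qx]].
  have [q qp] : exists q : {poly Z}, map_poly vz q = p.
    have /choice[c hc] : forall i, exists c : Z, vz c = p`_i.
      by move=> i; exists (exist (fun x => x \in dyadic_int hQ2) _ (p1 i) : Z).
    exists (\poly_(i < size p) c i); apply/polyP => i.
    rewrite coef_map coef_poly; case: ltnP => [_|pi]; first exact: hc.
    by rewrite nth_default.
  exists q; last by rewrite map_poly_comp qp.
  apply/eqP/val_inj; move/monicP: mp; rewrite -qp.
  by rewrite lead_coef_map_inj //; exact: val_inj.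
exists (map_poly vz q); split.
- exact: monic_map.
- by move=> i; rewrite coef_map; apply: abs_val.
- by rewrite -map_poly_comp.
Qed.

Lemma integers0 : O 0.
Proof. by apply/integersP; exact: mxpoly.integral0. Qed.
Lemma integers1 : O 1.
Proof. by apply/integersP; exact: mxpoly.integral1. Qed.
Lemma integers_nat n : O n%:R.
Proof. by apply/integersP; exact: mxpoly.integral_nat. Qed.
Lemma integersN x : O x -> O (- x).
Proof. by move/integersP => h; apply/integersP; apply: mxpoly.integral_opp. Qed.
Lemma integersD x y : O x -> O y -> O (x + y).
Proof. by move=> /integersP h /integersP k; apply/integersP;
  apply: mxpoly.integral_add. Qed.
Lemma integersM x y : O x -> O y -> O (x * y).
Proof. by move=> /integersP h /integersP k; apply/integersP;
  apply: mxpoly.integral_mul. Qed.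
Lemma integersB x y : O x -> O y -> O (x - y).
Proof. by move=> h k; apply: integersD => //; apply: integersN. Qed.
Lemma integers_sum I (s : seq I) (P : pred I) (h : I -> F) :
  (forall i, P i -> O (h i)) -> O (\sum_(i <- s | P i) h i).
Proof.
by move=> hO; apply: big_ind => //; [apply: integers0|apply: integersD].
Qed.
Lemma integers_in_alg (u : Q2) : abs u <= 1 -> O u%:A.
Proof.
move=> u1; apply/integersP.
exact: (mxpoly.integral_id f (exist (fun x => x \in dyadic_int hQ2) _ u1 : Z)).
Qed.
Lemma integers_horner (q : {poly Z}) x : O x -> O (map_poly f q).[x].
Proof.
move=> /integersP Ox; apply/integersP; apply: mxpoly.integral_horner => //.
apply/mxpoly.integral_poly => i; rewrite coef_map; exact: mxpoly.integral_id.
Qed.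

Lemma units_neq0 x : U x -> x != 0.
Proof. by case. Qed.
Lemma units1 : U 1.
Proof. by split; rewrite ?invr1 ?oner_eq0 //; apply: integers1. Qed.
Lemma unitsM x y : U x -> U y -> U (x * y).
Proof.
move=> [x0 Ox Ox'] [y0 Oy Oy']; split; rewrite ?mulf_neq0 ?invfM //;
  exact: integersM.
Qed.
Lemma unitsV x : U x -> U x^-1.
Proof. by move=> [x0 Ox Ox']; split; rewrite ?invr_eq0 ?invrK. Qed.
Lemma unitsN x : U x -> U (- x).
Proof.
by move=> [x0 Ox Ox']; split; rewrite ?oppr_eq0 ?invrN //; apply: integersN.
Qed.

Lemma two_neq0_ext : (2 : F) != 0.
Proof.
by rewrite -(rmorph_nat (in_alg F)) fmorph_eq0 (two_neq0 hQ2).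
Qed.

Lemma natr_eq0_ext n : (n%:R == 0 :> F) = (n == 0)%N.
Proof.
rewrite -(rmorph_nat (in_alg F)) fmorph_eq0; apply/idP/eqP => [|->] //.
apply: contraTeq => n0; have := @abs_int_neq0 _ _ _ hQ2 n n0.
by apply: contra => /eqP h; rewrite -pmulrn h (abs0 hQ2).
Qed.

Lemma quadratic_solution b : O b -> exists2 z, O z & z + 2 * z ^+ 2 = b.
Proof.
move=> Ob; have [p mp pb] := (integersP b).1 Ob.
have [q [d hq]] := contraction_fixpoint mp.
exists (map_poly f q).[b]; first exact: integers_horner.
have : (map_poly f ('X - 2 *: q ^+ 2)).[b] = (map_poly f (d * p + q)).[b]
  by rewrite hq.
move: pb; move: f => g /rootP pb.
rewrite rmorphB rmorphD rmorphM /= map_polyZ map_polyX rmorphXn /= rmorph_nat.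
rewrite !hornerE pb mulr0 add0r => hz.
by rewrite -{1}hz subrK.
Qed.

(* Elements of O independent over F_2 modulo 2 O are independent over Q_2: in a
   relation over Q_2, divide by the largest coefficient and reduce mod 2. *)
Definition free_mod2 n (o : 'I_n -> F) := (forall i, O (o i)) /\
  forall e : 'I_n -> bool, O ((\sum_i (e i)%:R * o i) / 2) -> forall i, e i =
    false.

Lemma free_mod2_dim n (o : 'I_n -> F) : free_mod2 o -> (n <= \dim {:F})%N.
Proof.
move=> [Oo ofree].
suff fr : free [tuple o i | i < n].
  have := dim_span [tuple o i | i < n]; rewrite (eqnP fr) size_tuple => _.
  have := fr; rewrite /free size_tuple => /eqP <-; exact: dimvS (subvf _).
apply/freeP => k rel i; apply/eqP; apply: contraT => ki.
pose i0 := [arg max_(j > i) abs (k j)]%O.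
have max_i0 j : abs (k j) <= abs (k i0).
  by rewrite /i0; case: (@arg_maxP _ _ _ i xpredT (fun j => abs (k j))) => // a
    _; apply.
have ki0 : k i0 != 0.
  apply: contraNneq ki => ki0; apply/eqP/(padic_abs_eq0 hQ2)/eqP.
  by have := max_i0 i; rewrite ki0 (abs0 hQ2) eq_le (padic_abs_ge0 hQ2) andbT.
pose c j := k j / k i0.
have c1 j : abs (c j) <= 1.
  rewrite (padic_absM hQ2) (absV hQ2) ler_pdivrMr ?mul1r //.
  rewrite lt_neqAle (padic_abs_ge0 hQ2) andbT eq_sym.
  by apply: contraNneq ki0 => /(padic_abs_eq0 hQ2) ->.
have /choice[e /choice[y hy]] : forall j, exists (b : bool), exists y : Q2,
    abs y <= 1 /\ c j = b%:R + 2 * y.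
  by move=> j; have [b [y y1 cy]] := residue_field_F2 hQ2 (c1 j); exists b, y.
have relc : \sum_j (c j)%:A * o j = 0.
  transitivity ((k i0)^-1 *: \sum_(j < n) k j *: [tuple o i | i < n]`_j);
    last first.
    by rewrite rel scaler0.
  rewrite scaler_sumr; apply: eq_bigr => j _.
  by rewrite scalerA mulr_algl -tnth_nth tnth_mktuple [_^-1 * _]mulrC.
have : O ((\sum_j (e j)%:R * o j) / 2).
  have -> : (\sum_j (e j)%:R * o j) / 2 = - \sum_j (y j)%:A * o j.
    apply: (mulIf two_neq0_ext); rewrite divfK ?two_neq0_ext //.
    apply/eqP; rewrite mulNr -subr_eq0 opprK mulr_suml -big_split /=; apply/eqP;
      rewrite -[RHS]relc.
    apply: eq_bigr => j _; have [_ ->] := hy j.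
    rewrite scalerDl mulrDl -scalerA; congr (_ * _ + _);
      first by rewrite -(rmorph_nat (in_alg F)).
    by rewrite scaler_nat mulr_natr mulrnAl.
  apply/integersN/integers_sum => j _; apply: integersM => //.
  by apply: integers_in_alg; have [] := hy j.
(* The coefficient at [i0] has been scaled to 1; were its residue 0, then 1 would be divisible by
   2. *)
move/ofree/(_ i0) => ei0; have [y1 cy] := hy i0.
move: cy; rewrite ei0 add0r /c divff // => cy.
have := abs1 hQ2; rewrite cy (padic_absM hQ2) (abs2 hQ2) => h.
have := y1; rewrite -(ler_pM2l (x := 2^-1)) ?invr_gt0 // h mulr1.
by rewrite leNgt invf_lt1 ?ltr1n.
Qed.

(** A family of maximal size among those free modulo 2 exists, its size being at most the degree of
    F. Adjoining x to it destroys freeness, and the resulting relation must involve x. *)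
Lemma integers_mod2_finite : exists L : seq F,
  (forall l, l \in L -> O l) /\ forall x, O x ->
    exists2 l, l \in L & O ((x - l) / 2).
Proof.
pose P n := exists o : 'I_n -> F, free_mod2 o.
have P0 : exists n, `[< P n >].
  by exists 0%N; apply/asboolP; exists (fun=> 0); split=> [[]|e _ []].
have Pmax n : `[< P n >] -> (n <= \dim {:F})%N.
  by move=> /asboolP[ o /free_mod2_dim].
case: (ex_maxnP P0 Pmax) => n /asboolP[ o [Oo ofree]] nmax.
exists [seq - \sum_i (e i)%:R * o i | e : {ffun 'I_n -> bool}].
split=> [l /mapP[e _ ->]|x Ox].
  by apply/integersN/integers_sum => i _; apply: integersM => //;
    apply: integers_nat.
pose o' (i : 'I_n.+1) := if unlift ord0 i is Some j then o j else x.
have o'_lift i : o' (lift ord0 i) = o i by rewrite /o' liftK.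
have o'0 : o' ord0 = x by rewrite /o' unlift_none.
have : ~ free_mod2 o' by move=> fo; have := nmax n.+1; rewrite ltnn => h;
  apply: notF; apply/h/asboolP; exists o'.
move=> nfree; apply: contrapT => hx; apply: nfree; split=> [i|e].
  by rewrite /o'; case: unliftP.
rewrite big_ord_recl o'0; under eq_bigr do rewrite o'_lift.
(* The relation reads x + \sum_i e_i o_i in 2 O, which explains the minus sign in the list of
   representatives. *)
case e0 : (e ord0).
  rewrite mul1r => he; case: hx; exists (- \sum_i (e (lift ord0 i))%:R * o i);
    last by rewrite opprK.
  apply/mapP; exists [ffun i => e (lift ord0 i)]; first by rewrite mem_enum.
  by congr (- _); apply: eq_bigr => i _; rewrite ffunE.
rewrite mul0r add0r => /(ofree (fun i => e (lift ord0 i))) he i.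
by case: (unliftP ord0 i) => [j ->|->].
Qed.

(** Three successive digits modulo 2: x is congruent to a + 2 b + 4 c. *)
Lemma integers_mod8_finite : exists L : seq F,
  forall x, O x -> exists2 l, l \in L & O ((x - l) / 8).
Proof.
have [L [_ hL]] := integers_mod2_finite.
exists [seq a + b | a <- L, b <- [seq 2 * c + 4 * d | c <- L, d <- L]] => x Ox.
have [a aL Oa] := hL _ Ox; have [b bL Ob] := hL _ Oa; have [c cL Oc] := hL _ Ob.
exists (a + (2 * b + 4 * c)).
  by apply: allpairs_f => //; apply: allpairs_f.
suff -> : (x - (a + (2 * b + 4 * c))) / 8 = ((((x - a) / 2 - b) / 2) - c) / 2
  by [].
by field; rewrite !natr_eq0_ext.
Qed.

Lemma unit_cong8_square u v : U u -> U v -> O ((u - v) / 8) ->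
  exists2 y, U y & u / v = y ^+ 2.
Proof.
move=> Uu Uv Ouv; have [v0 _ Ov'] := Uv.
have [z Oz hz] := quadratic_solution (integersM Ouv Ov').
have yy : u / v = (1 + 4 * z) ^+ 2.
  have -> : (1 + 4 * z) ^+ 2 = 1 + 8 * (z + 2 * z ^+ 2) by ring.
  by rewrite hz; field; rewrite v0 natr_eq0_ext.
have Oy : O (1 + 4 * z).
  by apply: integersD; [apply: integers1|apply: integersM => //;
    apply: integers_nat].
have Uuv : U (u / v) by apply: unitsM => //; apply: unitsV.
exists (1 + 4 * z) => //; split=> //.
  by have := units_neq0 Uuv; rewrite yy expf_eq0.
have y0 : 1 + 4 * z != 0 by have := units_neq0 Uuv; rewrite yy expf_eq0.
(* The inverse of the root is the root times the inverse of its square, and u / v is a unit. *)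
have -> : (1 + 4 * z)^-1 = (1 + 4 * z) * (u / v)^-1.
  by rewrite yy expr2 invfM mulrA divff // mul1r.
by apply: integersM => //; case: Uuv.
Qed.

(** * The Hilbert symbol and its radical R *)

Lemma hilbertC (a b : F) : hilbert a b = hilbert b a.
Proof.
rewrite /hilbert; congr (if _ then _ else _); apply/asboolP/asboolP.
  by move=> [x [y [z [n h]]]]; exists y, x, z; split;
    [move: n; rewrite !xpair_eqE [(x == 0) && _]andbC | rewrite h addrC].
by move=> [x [y [z [n h]]]]; exists y, x, z; split;
  [move: n; rewrite !xpair_eqE [(x == 0) && _]andbC | rewrite h addrC].
Qed.

Lemma hilbert_sign (a b : F) : hilbert a b = 1 \/ hilbert a b = -1.
Proof. by rewrite /hilbert; case: asboolP; [left|right]. Qed.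

Lemma hilbertNr (a : F) : hilbert a (- a) = 1.
Proof.
rewrite /hilbert asboolT //; exists 1, 1, 0; split;
  first by rewrite !xpair_eqE oner_eq0.
by rewrite !expr1n !mulr1 subrr expr0n.
Qed.

(** Discharged later by a computation in the double cover, rather than by local class field
    theory. *)
Hypothesis hilbertM : forall a b c : F, a != 0 -> b != 0 -> c != 0 ->
  hilbert a (b * c) = hilbert a b * hilbert a c.
Local Notation rad := (@unit_radical R Q2 abs F).

Lemma hilbertMl (a b c : F) : a != 0 -> b != 0 -> c != 0 ->
  hilbert (b * c) a = hilbert b a * hilbert c a.
Proof. by move=> a0 b0 c0; rewrite ![hilbert _ a]hilbertC hilbertM. Qed.

Lemma hilbert_sqr (a b : F) : hilbert a b * hilbert a b = 1.
Proof. by case: (hilbert_sign a b) => ->. Qed.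

Lemma hilbert1r (a : F) : a != 0 -> hilbert a 1 = 1.
Proof. by move=> a0; rewrite -[1 in LHS]mulr1 hilbertM ?oner_eq0 // hilbert_sqr.
  Qed.

Lemma hilbertVr (a b : F) : a != 0 -> b != 0 -> hilbert a b^-1 = hilbert a b.
Proof.
move=> a0 b0; rewrite -[LHS]mulr1 -(hilbert_sqr a b) mulrA -hilbertM
  ?invr_eq0 //.
by rewrite mulVf // hilbert1r // mul1r.
Qed.

(** A consequence of (a, -a) = 1. It matches the sign (k, k) of the Gauss sum with the sign (k, -1)
    of the conjugation by w_a(1). *)
Lemma hilbert_diag (a : F) : a != 0 -> hilbert a a = hilbert a (-1).
Proof.
move=> a0; rewrite -[RHS]mul1r -(hilbertNr a) -hilbertM ?oppr_eq0 ?oner_eq0 //.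
by rewrite mulrN1 opprK.
Qed.

Lemma rad_unit a : rad a -> U a. Proof. by case. Qed.

Lemma rad1 : rad 1.
Proof.
split=> [|b Ub]; first exact: units1.
by rewrite hilbertC hilbert1r // units_neq0.
Qed.

Lemma radM a b : rad a -> rad b -> rad (a * b).
Proof.
move=> [Ua ha] [Ub hb]; split=> [|c Uc]; first exact: unitsM.
by rewrite hilbertMl ?units_neq0 // ha ?hb.
Qed.

Lemma radV a : rad a -> rad a^-1.
Proof.
move=> [Ua ha]; split=> [|c Uc]; first exact: unitsV.
by rewrite hilbertC hilbertVr ?units_neq0 // hilbertC ha.
Qed.

Lemma rad_sqr a : U a -> rad (a ^+ 2).
Proof.
move=> Ua; rewrite expr2; split=> [|c Uc]; first exact: unitsM.
by rewrite hilbertMl ?units_neq0 // hilbert_sqr.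
Qed.

Lemma unit_rad_transversal : exists N (t : 'I_N -> F), [/\ forall i, U (t i),
  forall i j, rad (t i / t j) -> i = j & forall x, U x ->
    exists i, rad (x / t i)].
Proof.
have [L hL] := integers_mod8_finite.
apply: (@finite_transversal F F U (fun x y => rad (x / y)) L
  (fun x l => O ((x - l) / 8))).
- by move=> x y /radV; rewrite invf_div.
- move=> x [x0 Ox Ox']; have [l lL hl] := hL _ Ox.
  move: (lL); rewrite -index_mem => il.
  by exists (Ordinal il) => s0; rewrite nth_index.
- move=> x y s Ux Uy hx hy.
  have [|z Uz ->] := unit_cong8_square Ux Uy; last exact: rad_sqr.
  by have := integersB hx hy; rewrite -mulrBl opprB addrA subrK.
Qed.

End Integers.

(** * Simply laced root systems *)

Section Roots.
Variables (R : realType) (r : nat).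
Local Notation root := 'rV[R]_r.
Implicit Types a b d : root.

Lemma dotC a b : dot a b = dot b a.
Proof. by apply: eq_bigr => i _; rewrite mulrC. Qed.

Lemma dotDl a b d : dot (a + b) d = dot a d + dot b d.
Proof. by rewrite -big_split; apply: eq_bigr => i _; rewrite mxE mulrDl. Qed.

Lemma dotZl (k : R) a b : dot (k *: a) b = k * dot a b.
Proof. by rewrite mulr_sumr; apply: eq_bigr => i _; rewrite mxE mulrA. Qed.

Lemma dotNl a b : dot (- a) b = - dot a b.
Proof. by rewrite -scaleN1r dotZl mulN1r. Qed.

Lemma dotDr a b d : dot d (a + b) = dot d a + dot d b.
Proof. by rewrite dotC dotDl !(dotC d). Qed.

Lemma dotNr a b : dot a (- b) = - dot a b.
Proof. by rewrite dotC dotNl dotC. Qed.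

Lemma dotZr (k : R) a b : dot b (k *: a) = k * dot b a.
Proof. by rewrite dotC dotZl dotC. Qed.

Lemma dot_gt0 a : a != 0 -> 0 < dot a a.
Proof.
move=> a0; rewrite lt_neqAle sumr_ge0 ?andbT => [|i _]; last first.
  by rewrite -expr2 sqr_ge0.
rewrite eq_sym; apply: contraNneq a0 => da; apply/eqP/rowP => i; rewrite mxE.
apply/eqP; rewrite -sqrf_eq0 expr2; apply/eqP.
apply: (psumr_eq0P _ da) => // j _; first by rewrite -expr2 sqr_ge0.
Qed.

Variable Phi : seq root.
Hypothesis hPhi : root_system Phi.
Hypothesis hirr : root_irreducible Phi.
Hypothesis hsl : simply_laced Phi.

Lemma root_ne0 a : a \in Phi -> a != 0.
Proof. by apply: contraTneq => ->; apply: root_neq0 hPhi. Qed.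

Lemma root_dot_gt0 a : a \in Phi -> 0 < dot a a.
Proof. by move=> /root_ne0/dot_gt0. Qed.

Lemma cartan_dot a b : a \in Phi -> 2 * dot b a = cartan b a * dot a a.
Proof. by move=> aP; rewrite /cartan divfK // gt_eqF // root_dot_gt0. Qed.

Lemma cartan_diag a : a \in Phi -> cartan a a = 2.
Proof. by move=> aP; rewrite /cartan mulfK // gt_eqF // root_dot_gt0. Qed.

Lemma cartanDl a b d : cartan (a + b) d = cartan a d + cartan b d.
Proof. by rewrite /cartan dotDl mulrDr mulrDl. Qed.

Lemma cartanNl a b : cartan (- a) b = - cartan a b.
Proof. by rewrite /cartan dotNl mulrN mulNr. Qed.

Lemma cartanNr a b : cartan a (- b) = - cartan a b.
Proof. by rewrite /cartan !dotNr dotNl opprK mulrN mulNr. Qed.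

Lemma root_opp a : a \in Phi -> - a \in Phi.
Proof.
move=> aP; have := root_refl hPhi aP aP; rewrite cartan_diag //.
by rewrite scaler_nat mulr2n opprD addrA subrr add0r.
Qed.

Lemma root_oppE a : (- a \in Phi) = (a \in Phi).
Proof. by apply/idP/idP => /root_opp //; rewrite opprK. Qed.

(** Equal lengths in (a + b, a + b) = (a, a) + 2 (a, b) + (b, b) leave 2 (a, b) = - (a, a). *)
Lemma cartan_of_add a b : a \in Phi -> b \in Phi -> a + b \in Phi ->
  cartan b a = -1.
Proof.
move=> aP bP sP; have := cartan_dot b aP.
have := hsl sP aP; rewrite dotDl !dotDr (hsl bP aP) (dotC a b) => h1 h2.
have a0 := root_dot_gt0 aP; apply: (mulIf (lt0r_neq0 a0)).
by rewrite -h2; lra.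
Qed.

Lemma cartan_of_sub a b : a \in Phi -> b \in Phi -> b - a \in Phi ->
  cartan b a = 1.
Proof.
move=> aP bP sP; apply: oppr_inj; rewrite -cartanNr.
by apply: cartan_of_add; rewrite ?root_oppE // addrC.
Qed.

(** The Cartan integer is below 2, because (b - a, b - a) > 0 and the lengths agree; being positive
    it is 1, and b - a is the reflection of b in a. *)
Lemma sub_of_cartan_gt0 a b : a \in Phi -> b \in Phi -> b != a ->
  0 < cartan b a -> b - a \in Phi.
Proof.
move=> aP bP ba; have [k hk] := root_int hPhi aP bP.
rewrite -subr_eq0 in ba; have := dot_gt0 ba.
have := cartan_dot b aP; have a0 := root_dot_gt0 aP.
rewrite dotDl !dotDr !dotNl !dotNr (hsl bP aP) (dotC a b) hk => h1 h2.
rewrite ltr0z => k0.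
have k2 : (k%:~R : R) < 2.
  by rewrite -(ltr_pM2r a0); lra.
have k1 : k = 1 by rewrite -[2]/(2%:~R) ltr_int in k2; lia.
have := root_refl hPhi aP bP; by rewrite hk k1 scale1r.
Qed.

Lemma cartan_orth a b : a \in Phi -> b \in Phi -> b != a -> b != - a ->
  a + b \notin Phi -> b - a \notin Phi -> cartan b a = 0.
Proof.
move=> aP bP ba bNa nadd nsub; apply/eqP; rewrite eq_le; apply/andP; split.
  by rewrite leNgt; apply: contra nsub; apply: sub_of_cartan_gt0.
rewrite leNgt; apply: contra nadd => h.
rewrite addrC -[a]opprK; apply: sub_of_cartan_gt0; rewrite ?root_oppE //.
by rewrite cartanNr oppr_gt0.
Qed.

Section Addition.
Variables a b : root.
Hypotheses (aP : a \in Phi) (bP : b \in Phi) (abP : a + b \in Phi).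

Lemma add_root_neq : [/\ b != a, b != - a & a + b != 0].
Proof.
have h := cartan_of_add aP bP abP.
split; last exact: root_ne0.
  by apply/eqP => ba; move: h; rewrite ba cartan_diag //; lra.
by apply/eqP => ba; have := root_ne0 abP; rewrite ba subrr eqxx.
Qed.

Lemma sub_notin : b - a \notin Phi.
Proof.
by apply/negP => /(cartan_of_sub aP bP); rewrite (cartan_of_add aP bP abP); lra.
Qed.

Lemma add2_notin : a + (a + b) \notin Phi.
Proof.
apply/negP => /(cartan_of_add aP abP).
by rewrite cartanDl cartan_diag // (cartan_of_add aP bP abP); lra.
Qed.

Lemma add2_neq0 : a + (a + b) != 0.
Proof.
rewrite addr_eq0; apply/eqP => h; have := cartan_diag aP.
rewrite {1}h cartanNl cartanDl cartan_diag // (cartan_of_add aP bP abP); lra.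
Qed.

End Addition.

Hypothesis hr : (2 <= r)%N.

(** Rank at least 2 provides a root other than a and -a, and irreducibility one, v, that is not
    orthogonal to a. Then v - a or a + v is a root, and a = v + (a - v) or a = (a + v) + (- v). *)
Lemma root_decomp a : a \in Phi ->
  exists b d, [/\ b \in Phi, d \in Phi & a = b + d].
Proof.
move=> aP.
have [b [bP ba bNa]] : exists b, [/\ b \in Phi, b != a & b != - a].
  apply: contrapT => h.
  have : (fullv <= <[a]>)%VS.
    rewrite -(root_span hPhi); apply/span_subvP => b bP.
    have [->|ba] := eqVneq b a; first exact: memv_line.
    have [->|bNa] := eqVneq b (- a); first by rewrite memvN memv_line.
    by case: h; exists b.
  move/dimvS; rewrite dim_vline (root_ne0 aP) dimvf /dim /= mul1n.
  by rewrite leqNgt hr.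
have [||u [v [uP vP /orP hu /norP[va vNa] uv]]] := hirr (P := pred2 a (- a)).
- by exists a => //=; rewrite eqxx.
- by exists b => //=; rewrite negb_or ba.
have {uP hu uv} av : dot a v != 0.
  by case: hu uv => /eqP -> //; rewrite dotNl oppr_eq0.
have [vaP|nva] := boolP (v - a \in Phi).
  by exists v, (a - v); split;
    rewrite // -?[a - v]opprB ?root_oppE ?opprB // addrC subrK.
have [avP|nav] := boolP (a + v \in Phi).
  by exists (a + v), (- v); rewrite root_oppE addrK.
have := cartan_dot v aP; rewrite cartan_orth // mul0r => /eqP.
by rewrite mulf_eq0 pnatr_eq0 dotC (negbTE av).
Qed.

Variable Delta : r.-tuple root.
Hypothesis hDelta : simple_roots Phi Delta.

Lemma simple_coef_inj (m1 m2 : 'I_r -> R) :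
  \sum_i m1 i *: tnth Delta i = \sum_i m2 i *: tnth Delta i -> m1 =1 m2.
Proof.
move=> h i; apply/eqP; rewrite -subr_eq0; apply/eqP.
have /freeP fr := basis_free (simple_basis hDelta).
apply: (fr (fun i => m1 i - m2 i)).
transitivity (\sum_i m1 i *: tnth Delta i - \sum_i m2 i *: tnth Delta i);
  last first.
  by rewrite h subrr.
by rewrite -sumrB; apply: eq_bigr => j _; rewrite -tnth_nth scalerBl.
Qed.

(** Induction on the height, the sum of the simple coefficients: a positive root pairs positively
    with some simple root and, unless equal to it, stays a root after subtracting it. Combined with
    [h_add] and [h_opp], this reduces all h_a to the simple ones. *)
Lemma root_ind (P : root -> Prop) :
    (forall i, P (tnth Delta i)) ->
    (forall a, a \in Phi -> P a -> P (- a)) ->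
    (forall a b, a \in Phi -> b \in Phi -> a + b \in Phi ->
      P a -> P b -> P (a + b)) ->
  forall a, a \in Phi -> P a.
Proof.
move=> Ps PN PD.
have simpleP i : tnth Delta i \in Phi by apply: (simple_root hDelta);
  apply: mem_tnth.
suff pos k (m : 'I_r -> nat) : (\sum_i m i = k)%N ->
    \sum_i tnth Delta i *+ m i \in Phi -> P (\sum_i tnth Delta i *+ m i).
  move=> a aP; have [m [am|am]] := simple_pos_neg hDelta aP.
    by rewrite am; apply: (pos _ m erefl); rewrite -am.
  by rewrite am; apply: PN; [|apply: (pos _ m erefl)]; rewrite -root_oppE -am.
have natE (q : 'I_r -> nat) : \sum_i tnth Delta i *+ q i = \sum_i (q i)%:R *:
  tnth Delta i.
  by apply: eq_bigr => i _; rewrite scaler_nat.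
elim: k m => [|k ih] m mk.
  have -> : \sum_i tnth Delta i *+ m i = 0.
    apply: big1 => i _; have : (m i <= 0)%N by rewrite -mk (bigD1 i) //=
      leq_addr.
    by rewrite leqn0 => /eqP ->.
  by move=> /root_ne0; rewrite eqxx.
set a := \sum_i _ => aP.
(* Otherwise (a, a), a combination with nonnegative coefficients of the (a, alpha_i), would be at
   most 0. *)
have [i hi] : exists i, 0 < cartan a (tnth Delta i).
  apply: contrapT => nex; have := root_dot_gt0 aP.
  rewrite ltNge => /negP; apply.
  have -> : dot a a = \sum_i (m i)%:R * dot a (tnth Delta i).
    rewrite {2}/a natE; apply: (big_ind2 (fun u v => dot a u = v)).
    - by rewrite -[0 : root](scale0r (0 : root)) dotZr mul0r.
    - by move=> u u' v v' <- <-; rewrite dotDr.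
    - by move=> i _; rewrite dotZr.
  apply: sumr_le0 => i _; apply: mulr_ge0_le0 => //.
  rewrite leNgt; apply/negP => d0; apply: nex; exists i.
  rewrite -(pmulr_lgt0 _ (root_dot_gt0 (simpleP i))) -cartan_dot //.
  by rewrite mulr_gt0.
have [->|ai] := eqVneq a (tnth Delta i); first exact: Ps.
have bP := sub_of_cartan_gt0 (simpleP i) aP ai hi.
have aE : a = tnth Delta i + (a - tnth Delta i) by rewrite addrC subrK.
have bE : a - tnth Delta i = \sum_j ((m j)%:R - (j == i)%:R) *: tnth Delta j.
  rewrite {1}/a natE; under [RHS]eq_bigr do rewrite scalerBl.
  rewrite sumrB; congr (_ - _);
    rewrite (bigD1 i) //= eqxx scale1r big1 ?addr0 //.
  by move=> j /negbTE ->; rewrite scale0r.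
have [m' [bm|bm]] := simple_pos_neg hDelta bP.
  rewrite aE; apply: PD; rewrite -?aE // bm; apply: ih; last by rewrite -bm.
  move: bm; rewrite bE natE => /simple_coef_inj mm'.
  have hm j : (m j = m' j + (j == i))%N.
    by apply/eqP; rewrite -(@eqr_nat R) natrD -mm' subrK.
  move: mk; under eq_bigr do rewrite hm.
  rewrite big_split /= [X in (_ + X)%N](bigD1 i) //= eqxx.
  by rewrite [X in (_ + (_ + X))%N]big1 => [|j /negbTE -> //];
    rewrite addn0 addn1 => -[].
(* If a - alpha_i is a negative root, all coefficients of a except that of alpha_i vanish, and a is
   alpha_i itself. *)
have mm' j : (m j + m' j)%N = (j == i).
  move: bm; rewrite bE natE -sumrN; under [RHS]eq_bigr do rewrite -scaleNr.
  move/simple_coef_inj/(_ j) => h.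
  by apply/eqP; rewrite -(@eqr_nat R) natrD; apply/eqP; lra.
have mj j : j != i -> m j = 0%N.
  by move=> ji; have := mm' j; rewrite (negbTE ji) => /eqP;
    rewrite addn_eq0 => /andP[/eqP].
have aim : a = tnth Delta i *+ m i.
  by rewrite /a (bigD1 i) //= big1 ?addr0 // => j /mj ->.
have := mm' i; rewrite eqxx; case: (m i) aim => [|[|//]] h _.
  by have := root_ne0 aP; rewrite h eqxx.
by rewrite h; apply: Ps.
Qed.

(** * Signs of the Chevalley structure constants *)

Section Signs.
Variables (F : fieldType) (n : nat).
Variables (c : root -> root -> int) (E : root -> 'M[F]_n).
Hypothesis hE : chevalley_basis Phi c E.
Local Notation br := (@mxbracket F n).

Lemma mxbracketNC (X Y : 'M[F]_n) : br X Y = - br Y X.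
Proof. by rewrite /mxbracket opprB. Qed.

Lemma mxbracketZl (k : F) (X Y : 'M[F]_n) : br (k *: X) Y = k *: br X Y.
Proof. by rewrite /mxbracket -scalemxAl -scalemxAr scalerBr. Qed.

Lemma mxbracketZr (k : F) (X Y : 'M[F]_n) : br X (k *: Y) = k *: br X Y.
Proof. by rewrite /mxbracket -scalemxAl -scalemxAr scalerBr. Qed.

Lemma mxbracketx0 (X : 'M[F]_n) : br X 0 = 0.
Proof. by rewrite /mxbracket mulmx0 mul0mx subrr. Qed.

Lemma mxbracketDl (X Y W : 'M[F]_n) : br (X + Y) W = br X W + br Y W.
Proof. by rewrite /mxbracket mulmxDl mulmxDr opprD addrACA. Qed.

Lemma mxbracketNl (X Y : 'M[F]_n) : br (- X) Y = - br X Y.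
Proof. by rewrite -scaleN1r mxbracketZl scaleN1r. Qed.

Lemma mxbracketNr (X Y : 'M[F]_n) : br X (- Y) = - br X Y.
Proof. by rewrite -scaleN1r mxbracketZr scaleN1r. Qed.

Lemma mxbracket_jacobi (X Y W : 'M[F]_n) :
  br X (br Y W) = br (br X Y) W + br Y (br X W).
Proof.
rewrite /mxbracket !mulmxBr !mulmxBl !mulmxA !opprB.
rewrite [RHS]addrA !addrA.
set p := X *m Y *m W; set q := X *m W *m Y; set s := Y *m W *m X;
  set t := W *m Y *m X.
set u := Y *m X *m W; set v := W *m X *m Y.
apply/matrixP => i j; rewrite !mxE; ring.
Qed.

Section Pair.
Variables a b : root.
Hypotheses (aP : a \in Phi) (bP : b \in Phi) (abP : a + b \in Phi).

Lemma chev_c_anti : ((c b a)%:~R : F) = - (c a b)%:~R.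
Proof.
have := chev_bracket hE aP bP abP; rewrite mxbracketNC.
rewrite (chev_bracket hE bP aP) 1?addrC // -scaleNr => /eqP.
rewrite -subr_eq0 -scalerBl scaler_eq0 (negbTE (chev_neq0 hE abP)) orbF
  subr_eq0.
by rewrite eqr_oppLR => /eqP.
Qed.

(** In the Jacobi identity the term with [E_-a, E_b] vanishes, b - a not being a root; there remains
    - [H_a, E_b], and <b, a^vee> = -1. *)
Lemma double_bracket : br (E (- a)) (br (E a) (E b)) = E b.
Proof.
have [ba bNa ab0] := add_root_neq aP bP abP.
have NaP : - a \in Phi by rewrite root_oppE.
rewrite mxbracket_jacobi [br (E (- a)) (E b)](chev_bracket0 hE) //; last first.
- by rewrite addrC subr_eq0.
- by rewrite addrC sub_notin.
rewrite mxbracketx0 addr0 [br (E (- a)) _]mxbracketNC mxbracketNl.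
rewrite -/(coroot_mx E a) (@chev_coroot _ _ _ _ _ _ _ hE a b (-1)) //.
  by rewrite scaleN1r opprK.
by rewrite (cartan_of_add aP bP abP).
Qed.

(** Compares coefficients in [double_bracket]. This identity makes the unwanted factors cancel in
    the conjugation formulas for [w] and [h]. *)
Lemma chev_c_cancel : ((c (- a) (a + b))%:~R * (c a b)%:~R : F) = 1.
Proof.
have NaP : - a \in Phi by rewrite root_oppE.
have := double_bracket; rewrite (chev_bracket hE aP bP abP) mxbracketZr.
rewrite (chev_bracket hE NaP abP) addKr // scalerA => /eqP.
rewrite -[X in _ == X]scale1r -subr_eq0 -scalerBl scaler_eq0.
by rewrite (negbTE (chev_neq0 hE bP)) orbF subr_eq0 mulrC => /eqP.
Qed.

Lemma chev_c_sqr : ((c a b)%:~R * (c a b)%:~R : F) = 1.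
Proof. by case: (chev_c hE aP bP abP) => ->;
  rewrite ?mulr1 // mulrNN mulr1. Qed.

End Pair.

Section Pair2.
Variables a b : root.
Hypotheses (aP : a \in Phi) (bP : b \in Phi) (abP : a + b \in Phi).

(* Applying [[E_a, E_b], [E_-a, E_-b]] = - (H_a + H_b) to E_b. *)
Lemma chev_c_opp : ((c (- a) (- b))%:~R : F) = - (c a b)%:~R.
Proof.
have NaP : - a \in Phi by rewrite root_oppE.
have NbP : - b \in Phi by rewrite root_oppE.
have NabP : - a + - b \in Phi by rewrite -opprD root_oppE.
have baP : b + a \in Phi by rewrite addrC.
set X := br (E a) (E b).
have hX : br X (br (E (- a)) (E (- b))) = - (coroot_mx E a + coroot_mx E b).
  rewrite mxbracket_jacobi.
  have -> : br X (E (- a)) = - E b by rewrite mxbracketNC double_bracket.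
  have -> : br X (E (- b)) = E a.
    by rewrite mxbracketNC /X [br (E a) _]mxbracketNC mxbracketNr double_bracket
      ?opprK.
  rewrite mxbracketNl [br (E (- a)) _]mxbracketNC [RHS]opprD addrC.
  by rewrite /coroot_mx.
have := congr1 (fun Y => br Y (E b)) hX.
rewrite /X (chev_bracket hE aP bP abP) (chev_bracket hE NaP NbP NabP).
rewrite mxbracketZl mxbracketZr -opprD -/(coroot_mx E (a + b)) !mxbracketZl.
rewrite mxbracketNl mxbracketDl (@chev_coroot _ _ _ _ _ _ _ hE (a + b) b 1) //;
  last first.
  by apply: cartan_of_sub; rewrite // -root_oppE opprB addrK.
rewrite (@chev_coroot _ _ _ _ _ _ _ hE a b (-1)) ?(cartan_of_add aP bP abP) //.
rewrite (@chev_coroot _ _ _ _ _ _ _ hE b b 2) ?cartan_diag //.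
rewrite -scalerDl !scalerA -scaleNr => /eqP.
rewrite -subr_eq0 -scalerBl scaler_eq0 (negbTE (chev_neq0 hE bP)) orbF
  subr_eq0 => /eqP h.
have {h} h : (c a b)%:~R * (c (- a) (- b))%:~R = -1 :> F.
  by move: h; rewrite mulr1 -intrD.
transitivity ((c a b)%:~R * (c a b)%:~R * (c (- a) (- b))%:~R : F).
  by rewrite chev_c_sqr // mul1r.
by rewrite -mulrA h mulrN1.
Qed.

End Pair2.
End Signs.
End Roots.

(** * sl_2-triples *)

Section Sl2.
Variables (F : fieldType) (n : nat).
Hypothesis natF0 : forall k, (k.+1%:R : F) != 0.
Variables X Y H : 'M[F]_n.
Hypothesis XY : X *m Y = Y *m X + H.
Hypothesis HXc : H *m X = X *m H + 2 *: X.
Hypothesis HYc : H *m Y = Y *m H + (- 2) *: Y.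

Section Nilpotent.
Variables (A D : 'M[F]_n) (z : F).
Hypotheses (z0 : z != 0) (DA : D *m A = A *m D + z *: A).

Lemma weight_shift k : D *m A ^+ k = A ^+ k *m D + (z *+ k) *: A ^+ k.
Proof.
elim: k => [|k ih]; first by rewrite expr0 mulmx1 mul1mx mulr0n scale0r addr0.
rewrite exprS -[A * _]/(A *m _) mulmxA DA mulmxDl -mulmxA ih mulmxDr mulmxA.
rewrite -addrA; congr (_ + _); rewrite -scalemxAl -scalemxAr -scalerDl.
by rewrite mulrS addrC.
Qed.

(* On a row space on which A is invertible, A^-1 D A - D would be the scalar z,
   whose trace is nonzero. *)
Lemma ladder_rank k : \rank (A ^+ k.+1) = \rank (A ^+ k) -> A ^+ k = 0.
Proof.
move=> eqr; have [B [fB eB]] : exists B :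
  'M[F]_(\rank (A ^+ k), n), row_free B /\ eqmx B (A ^+ k).
  by exists (row_base (A ^+ k)); split;
    [apply: row_base_free|apply: eq_row_base].
have Bk : (B <= A ^+ k)%MS by rewrite eB.
have kB : (A ^+ k <= B)%MS by rewrite eB.
have [M hM] := submxP Bk.
have BA : (B *m A <= B)%MS.
  apply: submx_trans kB; rewrite hM -mulmxA -[A ^+ k *m A]/(A ^+ k * A) -exprSr
    exprS.
  by rewrite -[A * _]/(A *m _) mulmxA submxMl.
have BD : (B *m D <= B)%MS.
  apply: submx_trans kB; rewrite hM -mulmxA.
  have -> : A ^+ k *m D = (D - (z *+ k)%:M) *m A ^+ k.
    by rewrite mulmxBl weight_shift mul_scalar_mx addrK.
  by rewrite mulmxA submxMl.
have [A' hA] : exists A', A' *m B = B *m A.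
  by exists (B *m A *m pinvmx B); apply: mulmxKpV.
have [D' hD] : exists D', D' *m B = B *m D.
  by exists (B *m D *m pinvmx B); apply: mulmxKpV.
have rel : D' *m A' = A' *m D' + z *: A'.
  apply: (row_free_inj fB); rewrite /= mulmxDl -scalemxAl -!mulmxA hA hD !mulmxA
    hD hA.
  by rewrite -!mulmxA DA mulmxDr scalemxAr.
have A'u : A' \in unitmx.
  rewrite -row_free_unit /row_free -(mxrankMfree A' fB) hA.
  by rewrite (eqmxMr A eB) -[A ^+ k *m A]/(A ^+ k * A) -exprSr eqr.
have := congr1 (fun M => \tr (invmx A' *m M)) rel.
rewrite /= mulmxDr mulmxA -scalemxAr mulVmx // mulmxA mulVmx // mul1mx.
rewrite mxtrace_mulC mulmxA mulmxV // mul1mx linearD linearZ /= mxtrace1.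
move/eqP; rewrite -subr_eq0 opprD addrA subrr add0r oppr_eq0 mulf_eq0
  (negbTE z0) /=.
case: (\rank (A ^+ k)) (mxrank_eq0 (A ^+ k)) => [|j] h; first by move=> _;
  apply/eqP; rewrite -h.
by rewrite (negbTE (natF0 _)).
Qed.

(** By [ladder_rank] the ranks of the powers drop strictly until they reach 0. The exponent n is the
    one at which [exp_mx] is truncated. *)
Lemma ladder_nilpotent : A ^+ n = 0.
Proof.
suff h k : (k <= n)%N -> (\rank (A ^+ k) <= n - k)%N.
  by apply/eqP; rewrite -mxrank_eq0 -leqn0; have := h n (leqnn n);
    rewrite subnn.
elim: k => [|k ih] kn; first by rewrite subn0 rank_leq_row.
have le : (\rank (A ^+ k.+1) <= \rank (A ^+ k))%N by rewrite exprS mxrankM_maxr.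
have [e|] := eqVneq (\rank (A ^+ k.+1)) (\rank (A ^+ k)).
  by rewrite e (ladder_rank e) mxrank0.
by have := ih (ltnW kn); lia.
Qed.

Lemma exp_mxE t : exp_mx (t *: A) = \sum_(k < n) (t ^+ k / k`!%:R) *: A ^+ k.
Proof.
apply: eq_bigr => k _; rewrite mulrC -scalerA; congr (_ *: _).
by elim: (nat_of_ord k) => [|j ih];
  rewrite ?expr0 ?scale1r // !exprS ih -[LHS]/(_ *m _) -scalemxAl -scalemxAr
  scalerA.
Qed.

Lemma exp_comm t : A *m exp_mx (t *: A) = exp_mx (t *: A) *m A.
Proof.
rewrite exp_mxE mulmx_sumr mulmx_suml; apply: eq_bigr => k _.
rewrite -scalemxAl -scalemxAr; congr (_ *: _).
by rewrite -[A *m _]/(A * _) -[_ *m A]/(_ * A) -exprS exprSr.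
Qed.

(** The identity t d/dt exp(tA) = t A exp(tA); the top term lost by truncation is a multiple of A ^+
    n = 0. *)
Lemma exp_derivation t :
  \sum_(k < n) (t ^+ k / k`!%:R * k%:R) *: A ^+ k = t *: (A *m exp_mx (t *: A)).
Proof.
rewrite exp_mxE mulmx_sumr scaler_sumr.
have := ladder_nilpotent; case: (n) (A) => [|n'] B Bn.
  by rewrite !big_ord0.
rewrite big_ord_recl mulr0 scale0r add0r [RHS]big_ord_recr /=.
rewrite -scalemxAr -[B *m _]/(B * _) -exprS Bn !scaler0 addr0.
apply: eq_bigr => k _; rewrite -scalemxAr -[B *m _]/(B * _) -exprS scalerA.
congr (_ *: _); rewrite /bump add1n factS natrM exprS.
have f0 : (k`!%:R : F) != 0 by case: (k`!) (fact_gt0 k).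
by field; rewrite f0 addrC natr1 natF0.
Qed.

Lemma exp_weight t : D *m exp_mx (t *: A) =
  exp_mx (t *: A) *m (D + (t * z) *: A).
Proof.
rewrite mulmxDr -scalemxAr -exp_comm mulrC -scalerA -exp_derivation scaler_sumr.
rewrite exp_mxE mulmx_sumr mulmx_suml -big_split; apply: eq_bigr => k _ /=.
rewrite -scalemxAr weight_shift -scalemxAl scalerDr scalerA; congr (_ + _).
by rewrite scalerA; congr (_ *: _); rewrite -[z *+ k]mulr_natr; ring.
Qed.

End Nilpotent.

(** * Exponentials and Weyl elements of an sl_2-triple *)

Let Ntwo0 : (- 2 : F) != 0. Proof. by rewrite oppr_eq0. Qed.

(** The commutation formula for X and the powers of Y in the enveloping algebra of sl_2. *)
Lemma raise_lower k : X *m Y ^+ k.+1 =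
  Y ^+ k.+1 *m X + k.+1%:R *: (Y ^+ k *m H - k%:R *: Y ^+ k).
Proof.
elim: k => [|k ih].
  by rewrite scale0r subr0 expr0 mul1mx scale1r expr1.
rewrite exprSr -[Y ^+ k.+1 * Y]/(Y ^+ k.+1 *m Y) mulmxA ih mulmxDl -mulmxA XY
  mulmxDr.
rewrite mulmxA -addrA; congr (_ + _).
rewrite -scalemxAl mulmxBl -mulmxA HYc mulmxDr -scalemxAl -scalemxAr mulmxA.
rewrite -[Y ^+ k *m Y]/(Y ^+ k * Y) -exprSr.
move: (Y ^+ k.+1 *m H) (Y ^+ k.+1) => P Q.
by apply/matrixP => i j; rewrite !mxE -!natr1; ring.
Qed.

(** Conjugation of X by exp(sY) stops at order 2 in s because ad(Y)^3 X = 0; the terms are those of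
    [raise_lower]. *)
Lemma raise_exp s : X *m exp_mx (s *: Y) =
  exp_mx (s *: Y) *m (X + s *: H - (s * s) *: Y).
Proof.
have Yn := ladder_nilpotent Ntwo0 HYc.
have -> : exp_mx (s *: Y) *m (X + s *: H - (s * s) *: Y) =
  exp_mx (s *: Y) *m X +
    s *: (\sum_(k < n) (s ^+ k / k`!%:R) *: (Y ^+ k *m H - k%:R *: Y ^+ k)).
  rewrite mulmxBr mulmxDr -!scalemxAr -(exp_comm Y) -addrA; congr (_ + _).
  rewrite -scalerA -scalerBr; congr (_ *: _).
  rewrite -(exp_derivation Ntwo0 HYc) exp_mxE mulmx_suml -sumrB.
  by apply: eq_bigr => k _; rewrite -scalemxAl scalerBr scalerA.
rewrite exp_mxE mulmx_sumr mulmx_suml; move: Yn raise_lower.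
case: (n) X Y H => [|n'] A B C Bn low; first by rewrite !big_ord0 scaler0 addr0.
rewrite big_ord_recl [in RHS]big_ord_recl [in RHS]big_ord_recr /=.
(* Shifting the summation index leaves the term k = n - 1 on the right unmatched; [raise_lower] and
   Y ^+ n = 0 make it vanish. *)
have last0 : B ^+ n' *m C - n'%:R *: B ^+ n' = 0.
  have := low n'; rewrite Bn mulmx0 mul0mx add0r => /esym/eqP.
  by rewrite scaler_eq0 (negbTE (natF0 _)) => /eqP.
rewrite last0 scaler0 addr0 -addrA; congr (_ + _).
  by rewrite -scalemxAr -scalemxAl mulmx1 mul1mx.
rewrite scaler_sumr -big_split; apply: eq_bigr => k _ /=.
rewrite /bump add1n -scalemxAr low scalerDr -scalemxAl; congr (_ + _).
rewrite !scalerA; congr (_ *: _); rewrite factS natrM exprS.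
have f0 : (k`!%:R : F) != 0 by case: (k`!) (fact_gt0 k).
by field; rewrite f0 addrC natr1 natF0.
Qed.

Definition weyl_mx t := exp_mx (t *: X) *m exp_mx (- t^-1 *: Y) *m exp_mx
  (t *: X).

(** Passing through the three exponentials turns H into H + 2tX, then 2tX - H, and finally - H: the
    reflection on weights. *)
Lemma weyl_mx_anti t : t != 0 -> H *m weyl_mx t = - (weyl_mx t *m H).
Proof.
move=> t0; set e := exp_mx (t *: X); set s := - t^-1; set f := exp_mx (s *: Y).
have He : H *m e = e *m (H + (t * 2) *: X) by apply: exp_weight.
have Hf : H *m f = f *m (H + (s * -2) *: Y) by apply: exp_weight.
have Xf : X *m f = f *m (X + s *: H - (s * s) *: Y) by apply: raise_exp.
have Xe : X *m e = e *m X by apply: exp_comm.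
have ts : t * s = -1 by rewrite /s mulrN divff.
have step : (H + (t * 2) *: X) *m f = f *m ((t * 2) *: X - H).
  rewrite mulmxDl -scalemxAl Hf Xf scalemxAr -mulmxDr; congr (_ *m _).
  rewrite scalerBr scalerDr !scalerA.
  have -> : t * 2 * s = -2 by rewrite mulrAC ts mulN1r.
  have -> : t * 2 * (s * s) = -2 * s by rewrite mulrA [t * 2 * s]mulrAC ts
    mulN1r.
  by apply/matrixP => i j; rewrite !mxE; ring.
rewrite /weyl_mx -/s -/e -/f !mulmxA He -(mulmxA e) step -!mulmxA mulmxBl
  He -scalemxAl Xe.
rewrite scalemxAr -mulmxBr opprD addrCA subrr addr0 !mulmxN.
by rewrite !mulmxA.
Qed.

(** Independence of eigenspaces, for eigenvectors that may vanish or be dependent: the product of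
    the M - l over the eigenvalues l other than mu kills the other terms and multiplies the rest by
    a nonzero scalar. *)
Lemma eigen_component (I : finType) (y : I -> 'cV[F]_n) (lam a : I -> F)
  (M : 'M[F]_n) (mu : F) :
    (forall i, M *m y i = lam i *: y i) ->
    M *m (\sum_i a i *: y i) = mu *: \sum_i a i *: y i ->
  \sum_i a i *: y i = \sum_(i | lam i == mu) a i *: y i.
Proof.
move=> My MY; set Y0 := \sum_i a i *: y i in MY *.
pose L := [seq lam i | i <- enum I & lam i != mu].
pose Q := foldr (fun l P => (M - l%:M) *m P) 1%:M L.
pose p z := \prod_(l <- L) (z - l).
have Qv u z : M *m u = z *: u -> Q *m u = p z *: u.
  move=> Mu; rewrite /Q /p; elim: (L) => [|l L' ih] /=.
    by rewrite big_nil mul1mx scale1r.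
  rewrite big_cons -mulmxA ih -scalemxAr mulmxBl Mu mul_scalar_mx -scalerBl.
  by rewrite scalerA mulrC.
have pmu : p mu != 0.
  rewrite /p prodf_seq_neq0; apply/allP => l; rewrite {1}/L => /mapP[i iL ->];
    move: iL; rewrite mem_filter => /andP[li _] /=.
  by rewrite subr_eq0 eq_sym.
have plam i : lam i != mu -> p (lam i) = 0.
  move=> li; apply/eqP; rewrite prodf_seq_eq0; apply/hasP; exists (lam i);
    last by rewrite subrr eqxx.
  by apply/mapP; exists i; rewrite // mem_filter li mem_enum.
apply: (scalerI pmu); rewrite -Qv // {1}/Y0 mulmx_sumr
  (bigID (fun i => lam i == mu)) /=.
rewrite [X in _ + X]big1 ?addr0 => [|i li]; last first.
  by rewrite -scalemxAr (Qv _ _ _ (My i)) plam // scale0r scaler0.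
rewrite scaler_sumr; apply: eq_bigr => i /eqP li.
by rewrite -scalemxAr (Qv _ _ _ (My i)) li !scalerA mulrC.
Qed.

Lemma intr_inj_char0 (k : int) : (k%:~R == 0 :> F) -> k = 0.
Proof.
case: k => [[|k]|k] //; first by rewrite -pmulrn (negbTE (natF0 k)).
by rewrite NegzE mulrNz oppr_eq0 -pmulrn (negbTE (natF0 k)).
Qed.

(* A monomial of w(t) v of the correct weight -m carries the power t^-m, and
   all the other ones cancel. *)
Lemma weyl_mx_weight (v : 'cV[F]_n) (m : int) t : t != 0 -> H *m v = m%:~R *:
  v ->
  weyl_mx t *m v = t ^ (- m) *: (weyl_mx 1 *m v).
Proof.
move=> t0 Hv.
pose y (u : 'I_n * 'I_n * 'I_n) :=
  X ^+ u.1.1 *m (Y ^+ u.1.2 *m (X ^+ u.2 *m v)).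
pose d (u : 'I_n * 'I_n * 'I_n) : int := u.1.1%:Z - u.1.2%:Z + u.2%:Z.
pose cf s (u : 'I_n * 'I_n * 'I_n) : F :=
  s ^+ u.1.1 / (u.1.1)`!%:R * ((- s^-1) ^+ u.1.2 / (u.1.2)`!%:R) * (s ^+ u.2 /
    (u.2)`!%:R).
have expand s : weyl_mx s *m v = \sum_u cf s u *: y u.
  rewrite /weyl_mx !exp_mxE -!mulmxA mulmx_suml.
  rewrite -(pair_big xpredT xpredT (fun ij k => cf s (ij, k) *: y (ij, k))) /=.
  rewrite -(pair_big xpredT xpredT
    (fun i j => \sum_k cf s (i, j, k) *: y (i, j, k))) /=.
  apply: eq_bigr => i _; rewrite !mulmx_suml mulmx_sumr; apply: eq_bigr => j _.
  rewrite !mulmx_sumr; apply: eq_bigr => k _.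
  by rewrite /cf /y /= -!scalemxAl -!scalemxAr !scalerA; congr (_ *: _); ring.
have Hy u : H *m y u = (m + 2 * d u)%:~R *: y u.
  have shift (A : 'M[F]_n) z (hA : H *m A = A *m H + z *: A) k (p : 'cV[F]_n) mu
    :
      H *m p = mu *: p -> H *m (A ^+ k *m p) = (mu + z *+ k) *: (A ^+ k *m p).
    by move=> hp; rewrite mulmxA (weight_shift hA) mulmxDl -mulmxA
      hp -scalemxAr -scalemxAl scalerDl.
  rewrite (shift _ _ HXc _ _ _ (shift _ _ HYc _ _ _ (shift _ _ HXc _ _ _ Hv))).
  congr (_ *: _).
  rewrite /d intrD intrM intrD intrB -!pmulrn.
  by rewrite -(mulr_natr 2 u.2) -(mulr_natr (- 2) u.1.2) -(mulr_natr 2 u.1.1);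
    ring.
have key s : s != 0 -> weyl_mx s *m v =
    s ^ (- m) *: \sum_(u | (m + 2 * d u)%:~R == - m%:~R :> F) cf 1 u *: y u.
  move=> s0; have Hw : H *m (weyl_mx s *m v) = (- m%:~R) *: (weyl_mx s *m v).
    by rewrite mulmxA weyl_mx_anti // mulNmx -mulmxA Hv -scalemxAr scaleNr.
  rewrite expand in Hw *; rewrite (eigen_component Hy Hw) scaler_sumr.
  apply: eq_bigr => u; rewrite -subr_eq0 opprK -rmorphD => /intr_inj_char0 hd.
  (* Weight - m means m + 2 d = - m, and d is also the exponent of s in [cf s u]; all surviving
     terms thus share the power s ^ (- m). *)
  have {}hd : - m = d u by lia.
  rewrite scalerA; congr (_ *: _); rewrite /cf invr1 !expr1n hd /d.
  rewrite !expfzDr // -exprnN -!exprnP -[- s^-1]mulN1r exprMn exprVn; ring.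
by rewrite key // [in RHS]key ?oner_eq0 // exp1rz scale1r.
Qed.

End Sl2.

(** * Irreducible constituents *)

Section Constituent.
Variables (R : realType) (Gt : groupType) (H : set Gt) (N : nat).
Variable D : Gt -> 'M[R[i]]_N.
Hypotheses (N0 : (0 < N)%N) (D1 : D 1%g = 1%:M).
(** The matrices act on row vectors from the right, so reversing products is what makes v |-> v *m D
    g a left action. *)
Hypothesis DM : forall g h, H g -> H h -> D (g * h)%g = D h *m D g.

Let stable m (W : 'M[R[i]]_(m, N)) := forall g, H g -> (W *m D g <= W)%MS.

Lemma minimal_stable : exists d (B : 'M[R[i]]_(d, N)),
  [/\ (0 < d)%N, row_free B,
  stable B & forall W : 'M[R[i]]_N, W != 0 -> stable W -> (d <= \rank W)%N].
Proof.
pose P k := (0 < k)%N && `[< exists2 W : 'M[R[i]]_N, \rank W = k & stable W >].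
have PN : exists k, P k.
  exists N; rewrite /P N0; apply/asboolP; exists 1%:M; first exact: mxrank1.
  by move=> g _; apply: submx1.
case: (ex_minnP PN) => d /andP[d0 /asboolP[W rW sW]] dmin.
exists (\rank W), (row_base W); split.
- by rewrite rW.
- exact: row_base_free.
- by move=> g Hg; rewrite (eqmxMr _ (eq_row_base W)) eq_row_base sW.
- move=> W' W'0 sW'; rewrite rW; apply: dmin.
  by rewrite /P lt0n mxrank_eq0 W'0; apply/asboolP; exists W'.
Qed.

(** A nonzero stable subspace of least dimension is irreducible. The clause on scalars transports
    genuineness and triviality on T_R, which both say that certain matrices [D g] are scalar. *)
Lemma irreducible_constituent :
  exists (V : lmodType R[i]) (tau : Gt -> {linear V -> V}),
  [/\ representation H tau, irreducible_rep H tau &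
     forall g (z : R[i]), D g = z%:M -> forall v, tau g v = z *: v].
Proof.
have [d [B [d0 fB sB Bmin]]] := minimal_stable.
pose M g := B *m D g *m pinvmx B.
have MB g : H g -> M g *m B = B *m D g by move=> Hg; apply/mulmxKpV/sB.
have Mscal g z : D g = z%:M -> M g = z%:M.
  by move=> Dg; rewrite /M Dg mul_mx_scalar -scalemxAl mulmxVp // scalemx1.
pose tau g : {linear 'rV[R[i]]_d -> 'rV[R[i]]_d} := mulmxr (M g).
exists 'rV[R[i]]_d, tau; split; last 1 first.
- by move=> g z Dg v; rewrite /tau /= (Mscal g z Dg) mul_mx_scalar.
- split=> [v|g h Hg Hh v]; first by rewrite /tau /= (Mscal _ 1) ?mulmx1.
  rewrite /tau /= -mulmxA; congr (_ *m _).
  by rewrite {1}/M DM // (mulmxA B) -(MB _ Hh) /M !mulmxA.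
split; first by exists (delta_mx 0 (Ordinal d0));
  apply/eqP => /matrixP/(_ 0 (Ordinal d0));
  rewrite !mxE !eqxx => /eqP; rewrite oner_eq0.
move=> U [U0 UC] Ustab.
have UD u v : u \in U -> v \in U -> u + v \in U.
  by move=> uU vU; have := UC 1 u v uU vU; rewrite scale1r.
have UZ z u : u \in U -> z *: u \in U.
  by move=> uU; have := UC z u 0 uU U0; rewrite addr0.
case: (pselect (exists2 u, u \in U & u != 0)) => [[u0 u0U u0n]|nU]; last first.
  by left=> v vU; apply/eqP; apply: contrapT => /negP vn; apply: nU; exists v.
right.
(* [U] is a bare predicate closed under linear combinations; a matrix of maximal rank with row space
   inside [U] has row space exactly [U], which makes rank arguments available. *)
pose Q (W : 'M[R[i]]_d) := forall v : 'rV_d, (v <= W)%MS -> v \in U.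
pose P k := `[< exists2 W : 'M[R[i]]_d, \rank W = k & Q W >].
have P0 : exists k, P k.
  exists 0%N; apply/asboolP; exists 0; first exact: mxrank0.
  by move=> v; rewrite submx0 => /eqP ->.
have Pd k : P k -> (k <= d)%N by move=> /asboolP[W <- _]; apply: rank_leq_row.
case: (ex_maxnP P0 Pd) => k /asboolP[W rW QW] kmax.
have UW u : u \in U -> (u <= W)%MS.
  move=> uU; have QWu : Q (W + u)%MS.
    move=> v /sub_addsmxP[[a b] /= ->]; apply: UD; first by apply: QW;
      apply: submxMl.
    have [c ->] : exists c, b *m u = c *: u.
      by exists (b 0 0); rewrite [b in LHS]mx11_scalar mul_scalar_mx.
    exact: UZ.
  have /kmax : P (\rank (W + u)%MS) by apply/asboolP; exists (W + u)%MS.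
  rewrite -rW => le; apply: submx_trans (addsmxSr W u) _.
  by rewrite -(geq_leqif (mxrank_leqif_sup (addsmxSl W u))).
have W0 : W != 0.
  by apply: contraNneq u0n => W0; have := UW _ u0U; rewrite W0 submx0.
have sWB : stable (W *m B).
  move=> g Hg; rewrite -mulmxA -MB // mulmxA submxMr //.
  apply/row_subP => i; rewrite row_mul; apply: UW.
  by apply: (Ustab g (row i W)) => //; apply: QW; apply: row_sub.
have rWB : \rank (W *m B) = \rank W by apply: mxrankMfree.
have [W' W'E] : exists W' : 'M[R[i]]_N, eqmx W' (W *m B).
  by exists <<W *m B>>%MS; apply: genmxE.
have := Bmin W'; rewrite -mxrank_eq0 W'E rWB mxrank_eq0 => /(_ W0) dW.
have fullW : row_full W.
  rewrite /row_full eqn_leq rank_leq_row dW //.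
  by move=> g Hg; rewrite (eqmxMr _ W'E) W'E sWB.
by move=> v; apply: QW; apply: submx_full.
Qed.

End Constituent.

(** * The double cover and its torus *)

Lemma subgroup_gen (G : groupType) (S H : set G) :
  is_subgroup H -> (forall g, S g -> H g) -> forall g, generated S g -> H g.
Proof. by move=> sH SH g; apply; split. Qed.

Lemma generated_subgroup (G : groupType) (S : set G) :
  is_subgroup (generated S).
Proof.
split=> [H [[]]//|g h gS hS H HS]; move: (HS) => [[_ HM] _].
by apply: HM; [apply: gS|apply: hS].
Qed.

Lemma mem_generated (G : groupType) (S : set G) g : S g -> generated S g.
Proof. by move=> Sg H [_]; apply. Qed.

Section Subgroup.
Variables (G : groupType) (H : set G).
Hypothesis sH : is_subgroup H.

Lemma sub1g : H 1%g. Proof. by case: sH. Qed.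
Lemma subVg g : H g -> H g^-1%g.
Proof. by move=> Hg; rewrite -[g^-1%g]mul1g; apply: sH.2 => //;
  apply: sub1g. Qed.
Lemma subMg g h : H g -> H h -> H (g * h)%g.
Proof. by move=> Hg Hh; rewrite -[h]invgK; apply: sH.2 => //; apply: subVg. Qed.

End Subgroup.

Section Cover.
Variables (R : realType) (Q2 : fieldType) (abs : Q2 -> R).
Hypothesis hQ2 : padic_completion 2 abs.
Variable F : fieldExtType Q2.
Variables (r : nat) (Phi : seq 'rV[R]_r).
Hypotheses (hr : (2 <= r)%N) (hPhi : root_system Phi).
Hypotheses (hirr : root_irreducible Phi) (hsl : simply_laced Phi).
Variables (Delta : r.-tuple 'rV[R]_r).
Hypothesis hDelta : simple_roots Phi Delta.
Variables (n : nat) (c : 'rV[R]_r -> 'rV[R]_r -> int) (E : 'rV[R]_r -> 'M[F]_n).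
Hypothesis hE : chevalley_basis Phi c E.
Variables (G Gt : topGroupType) (x : 'rV[R]_r -> F -> G).
Variables (pr : {multiplicative Gt -> G}) (eps : Gt).
Hypothesis hGt : topological_double_cover pr eps.
Variable xt : 'rV[R]_r -> F -> Gt.
Hypothesis hxt : cover_relations Phi c x pr eps xt.
Local Notation root := 'rV[R]_r.
Implicit Types (a b d : root) (t u v s : F) (g h : Gt).
Local Notation w := (chev_w xt).
Local Notation h := (chev_h xt).
Local Notation mu := (mu2 eps).
Local Notation U := (@integer_units R Q2 abs F).
Local Notation rad := (@unit_radical R Q2 abs F).

Lemma pr1 : pr 1%g = 1%g.
Proof. by apply/(cover_ker hGt); left. Qed.

Lemma prV g : pr g^-1%g = (pr g)^-1%g.
Proof. by apply: (mulgI (pr g)); rewrite -gmulfM !mulgV pr1. Qed.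

Lemma pr_eps : pr eps = 1%g.
Proof. by apply/(cover_ker hGt); right. Qed.

Lemma pr_eq g g' : pr g = pr g' -> g = g' \/ g = (eps * g')%g.
Proof.
move=> e; have : pr (g * g'^-1)%g = 1%g by rewrite gmulfM prV e mulgV.
move/(cover_ker hGt) => [h|h]; [left|right].
  by rewrite -[g](mulgVK g') h mul1g.
by rewrite -[g in LHS](mulgVK g') h.
Qed.

Lemma eps_eps : (eps * eps)%g = 1%g.
Proof.
have : pr (eps * eps)%g = 1%g by rewrite gmulfM pr_eps mulg1.
move/(cover_ker hGt) => [//|h].
by have := cover_eps hGt; rewrite -(inj_eq (mulgI eps)) h mulg1 eqxx.
Qed.

Lemma mu_central (z : int) g : commute (mu z) g.
Proof.
rewrite /mu2; case: ifP => _; first exact/commute_sym/commute1.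
exact: cover_central hGt g.
Qed.

Lemma mu_sqr (z : int) : (mu z * mu z)%g = 1%g.
Proof. by rewrite /mu2; case: ifP; rewrite ?mulg1 ?eps_eps. Qed.

Lemma pr_mu z : pr (mu z) = 1%g.
Proof. by rewrite /mu2; case: ifP; rewrite ?pr1 ?pr_eps. Qed.

Lemma mu_hilbertM t u t' u' :
  (mu (hilbert t u) * mu (hilbert t' u'))%g = mu (hilbert t u * hilbert t' u').
Proof.
case: (hilbert_sign t u) => ->; case: (hilbert_sign t' u') => ->;
by rewrite /mu2 /= ?mulg1 ?mul1g ?eps_eps.
Qed.

(** Since [eps] differs from 1, identities between symbols can be proved as identities in the
    cover. *)
Lemma mu_hilbert_inj t u (s : int) : s = 1 \/ s = -1 ->
  mu (hilbert t u) = mu s -> hilbert t u = s.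
Proof.
have e1 := cover_eps hGt.
case: (hilbert_sign t u) => ->; case=> -> //; rewrite /mu2 /= => e; move: e1.
  by rewrite -e eqxx.
by rewrite e eqxx.
Qed.

Lemma conj_mu (s : int) g g' : (g ^ (mu s * g') = g ^ g')%g.
Proof. by rewrite conjgM; congr (_ ^ _)%g;
  apply/conjg_fixP/commgP/commute_sym/mu_central. Qed.

Section OneRoot.
Variable a : root.
Hypothesis aP : a \in Phi.

Lemma xt0 : xt a 0 = 1%g.
Proof. by apply: (mulgI (xt a 0)); rewrite (xt_add hxt) // addr0 mulg1. Qed.

Lemma xtV t : ((xt a t)^-1)%g = xt a (- t).
Proof. by apply: mulg1_eq; rewrite (xt_add hxt) // subrr xt0. Qed.

End OneRoot.

Lemma wV a t : a \in Phi -> ((w a t)^-1)%g = w a (- t).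
Proof.
move=> aP; have NaP : - a \in Phi by rewrite root_oppE.
by rewrite /chev_w !invgM !xtV // mulgA invrN.
Qed.

Lemma h1 a : a \in Phi -> h a 1 = 1%g.
Proof. by move=> aP; rewrite /chev_h -wV // mulgV. Qed.

Lemma hM a t u : a \in Phi -> t != 0 -> u != 0 ->
  (h a t * h a u)%g = (mu (hilbert t u) * h a (t * u))%g.
Proof. exact: (ht_mul hxt). Qed.

Lemma hM' a t u : a \in Phi -> t != 0 -> u != 0 ->
  h a (t * u) = (mu (hilbert t u) * (h a t * h a u))%g.
Proof. by move=> aP t0 u0; rewrite hM // mulgA mu_sqr mul1g. Qed.

Lemma w_ratio a t s : a \in Phi -> (w a t * w a (- s))%g =
  (h a t * (h a s)^-1)%g.
Proof. by move=> aP; rewrite /chev_h mulgKA wV. Qed.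

(** The symbol comes from splitting h_a(-s) into h_a(s) h_a(-1). *)
Lemma w_minus_one a s : a \in Phi -> s != 0 ->
  (w a (- s) * w a 1)%g = (mu (hilbert s (-1)) * h a s)%g.
Proof.
move=> aP s0; have N10 : (-1 : F) != 0 by rewrite oppr_eq0 oner_eq0.
have -> : w a 1 = ((w a (-1)) * (h a (-1))^-1)%g.
  by rewrite /chev_h invgM mulVKg wV // opprK.
have : h a (- s) = (mu (hilbert s (-1)) * (h a s * h a (-1)))%g
  by rewrite -hM' // mulrN1.
rewrite {1}/chev_h; move: (mu _) (h a s) (h a (-1)) (w a (- s)) (w a (-1)) => m
  p q y z e.
by rewrite mulgA e -!mulgA mulgV mulg1.
Qed.

(** * Conjugation of root subgroups by Weyl and torus elements *)

Lemma xt_conj a b t u : a \in Phi -> b \in Phi -> a + b \in Phi ->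
  (xt b u ^ xt a t)%g = (xt b u * xt (a + b) (- (c a b)%:~R * t * u))%g.
Proof.
move=> aP bP sP; rewrite -[LHS](mulVKg (xt b u)) -commgEl.
rewrite (xt_comm hxt) 1?addrC // (chev_c_anti hE aP) //.
by rewrite [a + b]addrC -!mulrA [u * t]mulrC.
Qed.

Lemma xt_conj0 a b t u : a \in Phi -> b \in Phi -> a + b \notin Phi ->
  a + b != 0 ->
  (xt b u ^ xt a t)%g = xt b u.
Proof.
by move=> aP bP s0 sP; apply/conjg_fixP/eqP; rewrite (xt_comm1 hxt) // addrC.
Qed.

(** The first factor of w_a(t) turns x_b(u) into x_b(u) x_{a+b}(v); the middle one creates an
    x_b(-u), by [chev_c_cancel], which removes x_b(u); the last one fixes x_{a+b}(v). *)
Lemma wJ_add a b t u : a \in Phi -> b \in Phi -> a + b \in Phi -> t != 0 ->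
  (xt b u ^ w a t)%g = xt (a + b) (- (c a b)%:~R * t * u).
Proof.
move=> aP bP sP t0; have NaP : - a \in Phi by rewrite root_oppE.
have [ba bNa s0] := add_root_neq hPhi hsl aP bP sP.
have baP : b + a \in Phi by rewrite addrC.
have sub := sub_notin hPhi hsl aP bP sP.
rewrite /chev_w !conjgM (xt_conj t u aP bP sP) (conjMg (xt b u)).
rewrite [(xt b u ^ xt (- a) _)%g]xt_conj0 //; last by rewrite addrC subr_eq0.
  2: by rewrite addrC.
rewrite (@xt_conj (- a)) // ?addKr //.
have -> : - (c (- a) (a + b))%:~R * - t^-1 * (- (c a b)%:~R * t * u) = - u :> F.
  transitivity (- ((c (- a) (a + b))%:~R * (c a b)%:~R) * u * (t^-1 * t)).
    by ring.
  by rewrite (chev_c_cancel hPhi hsl hE) // mulVf // mulr1 mulN1r.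
have comm : commute (xt (a + b) (- (c a b)%:~R * t * u)) (xt b (- u)).
  apply/commute_sym/commgP/eqP; apply: (xt_comm1 hxt) => //.
    by rewrite [a + b]addrC (add2_neq0 hPhi hsl bP aP baP).
  by rewrite [a + b]addrC (add2_notin hPhi hsl bP aP baP).
rewrite comm mulgA (xt_add hxt) // subrr xt0 // mul1g.
rewrite xt_conj0 //; first exact: add2_notin.
exact: (add2_neq0 hPhi hsl aP bP sP).
Qed.

Lemma wJ_sub a b t u : a \in Phi -> b \in Phi -> b - a \in Phi -> t != 0 ->
  (xt b u ^ w a t)%g = xt (b - a) ((c (- a) b)%:~R * t^-1 * u).
Proof.
move=> aP bP sP t0; have NaP : - a \in Phi by rewrite root_oppE.
have sP' : - a + b \in Phi by rewrite addrC.
have baP' : b + - a \in Phi by [].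
have bE : a + (b - a) = b by rewrite addrC subrK.
have baP : a + (b - a) \in Phi by rewrite bE.
have [ba bNa s0] := add_root_neq hPhi hsl NaP bP sP'.
have sum := sub_notin hPhi hsl NaP bP sP'; rewrite opprK in ba sum.
have bfix y : (xt b y ^ xt a t)%g = xt b y.
  rewrite xt_conj0 //; first by rewrite addrC.
  by rewrite opprK in bNa; rewrite addrC addr_eq0.
rewrite /chev_w !conjgM bfix (xt_conj _ _ NaP bP sP') conjMg bfix addrC.
set v := _ * u; rewrite (xt_conj _ _ aP sP baP) bE.
have -> : v = (c (- a) b)%:~R * t^-1 * u by rewrite /v; ring.
set v' := - (c a (b - a))%:~R * t * _; have -> : v' = - u.
  have := chev_c_cancel hPhi hsl hE NaP bP sP'; rewrite opprK addrC => h0.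
  transitivity (- ((c a (b - a))%:~R * (c (- a) b)%:~R) * u * (t * t^-1)).
    by rewrite /v'; ring.
  by rewrite h0 divff // mulr1 mulN1r.
have comm : commute (xt (b - a) ((c (- a) b)%:~R * t^-1 * u)) (xt b (- u)).
  apply/commute_sym/commgP/eqP; apply: (xt_comm1 hxt) => //.
    exact: (add2_neq0 hPhi hsl bP NaP baP').
  exact: (add2_notin hPhi hsl bP NaP baP').
by rewrite comm mulgA (xt_add hxt) // subrr xt0 // mul1g.
Qed.

(** w_a(t) moves x_b to the other end of its a-string and w_a(-1) brings it back; the signs cancel
    and the factor t remains. *)
Lemma hJ_add a b t u : a \in Phi -> b \in Phi -> a + b \in Phi -> t != 0 ->
  (xt b u ^ h a t)%g = xt b (t * u).
Proof.
move=> aP bP sP t0; rewrite /chev_h conjgM wJ_add // wJ_sub //;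
  last by rewrite oppr_eq0 oner_eq0.
  rewrite addrC addKr invrN1 mulrN1; congr xt.
  transitivity ((c (- a) (a + b))%:~R * (c a b)%:~R * (t * u)); first ring.
  by rewrite (chev_c_cancel hPhi hsl hE) // mul1r.
by rewrite addrC addKr.
Qed.

Lemma hJ_sub a b t u : a \in Phi -> b \in Phi -> b - a \in Phi -> t != 0 ->
  (xt b u ^ h a t)%g = xt b (t^-1 * u).
Proof.
move=> aP bP sP t0; have NaP : - a \in Phi by rewrite root_oppE.
have bE : a + (b - a) = b by rewrite addrC subrK.
have sP' : - a + b \in Phi by rewrite addrC.
rewrite /chev_h conjgM wJ_sub // wJ_add ?bE //;
  last by rewrite oppr_eq0 oner_eq0.
congr xt; have := chev_c_cancel hPhi hsl hE NaP bP sP';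
  rewrite opprK addrC => h0.
transitivity ((c a (b - a))%:~R * (c (- a) b)%:~R * (t^-1 * u)); first by ring.
by rewrite h0 mul1r.
Qed.

Lemma hJ_orth a b t u : a \in Phi -> b \in Phi -> b != a -> b != - a ->
  a + b \notin Phi -> b - a \notin Phi -> (xt b u ^ h a t)%g = xt b u.
Proof.
move=> aP bP ba bNa nadd nsub; have NaP : - a \in Phi by rewrite root_oppE.
have ab0 : a + b != 0 by rewrite addrC addr_eq0.
have ab0' : - a + b != 0 by rewrite addrC subr_eq0.
rewrite addrC in nsub.
by rewrite /chev_h /chev_w !conjgM !(xt_conj0 _ _ aP, xt_conj0 _ _ NaP).
Qed.

Lemma xt_decomp b d t : b \in Phi -> d \in Phi -> b + d \in Phi ->
  xt (b + d) t = [~ xt b 1, xt d ((c b d)%:~R * t)]%g.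
Proof.
move=> bP dP sP; rewrite (xt_comm hxt) // mulr1 mulrA (chev_c_sqr hE) //.
by rewrite mul1r.
Qed.

(** With a = b + d, the element x_a is a commutator of x_b and x_d, each of which is scaled by
    t^-1. *)
Lemma hJ_self a t u : a \in Phi -> t != 0 ->
  (xt a u ^ h a t)%g = xt a (t^-1 ^+ 2 * u).
Proof.
move=> aP t0; have [b [d [bP dP ae]]] := root_decomp hPhi hirr hsl hr aP.
have sP : b + d \in Phi by rewrite -ae.
rewrite {1}ae (xt_decomp u bP dP sP) conjRg !hJ_sub //.
- rewrite (xt_comm hxt) // -ae; congr xt.
  transitivity ((c b d)%:~R * (c b d)%:~R * (t^-1 ^+ 2 * u)); first by ring.
  by rewrite (chev_c_sqr hE) // mul1r.
- by rewrite ae opprD addrCA subrr addr0 root_oppE.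
- by rewrite ae opprD addrA subrr add0r root_oppE.
Qed.

Lemma hJ_opp a t u : a \in Phi -> t != 0 ->
  (xt (- a) u ^ h a t)%g = xt (- a) (t ^+ 2 * u).
Proof.
move=> aP t0; have NaP : - a \in Phi by rewrite root_oppE.
have [b [d [bP dP ae]]] := root_decomp hPhi hirr hsl hr NaP.
have sP : b + d \in Phi by rewrite -ae.
have ae' : a = - (b + d) by rewrite -ae opprK.
rewrite {1}ae (xt_decomp u bP dP sP) conjRg !hJ_add //.
- rewrite (xt_comm hxt) // -ae; congr xt.
  transitivity ((c b d)%:~R * (c b d)%:~R * (t ^+ 2 * u)); first by ring.
  by rewrite (chev_c_sqr hE) // mul1r.
- by rewrite ae' opprD addrNK root_oppE.
- by rewrite ae' opprD addrAC addNr add0r root_oppE.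
Qed.

(** The value [k b] is the factor by which g scales the root subgroup of b. The condition at - b is
    the one under which conjugation sends w_b(v) to w_b(k v), as w_b involves x_{-b}(- v^-1). *)
Definition acts g (k : root -> F) := forall b, b \in Phi ->
  [/\ k b != 0, k (- b) = (k b)^-1 & forall u, (xt b u ^ g)%g = xt b (k b * u)].

(** This is t ^ (- <b, a^vee>), the cases being the Cartan integers 2, -2, -1, 1 and 0; the minus
    sign reflects that [x ^ g] is g^-1 x g. *)
Definition hchar a t b : F :=
  if b == a then t^-1 ^+ 2 else if b == - a then t ^+ 2
  else if a + b \in Phi then t else if b - a \in Phi then t^-1 else 1.

Lemma hchar_opp a t b : a \in Phi -> b \in Phi -> hchar a t (- b) =
  (hchar a t b)^-1.
Proof.
move=> aP bP; have NbP : - b \in Phi by rewrite root_oppE.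
have a0 := root_ne0 hPhi aP.
have aNa : a == - a = false.
  by apply/negbTE; rewrite -addr_eq0 -mulr2n -scaler_nat scaler_eq0 pnatr_eq0.
rewrite /hchar eqr_oppLR eqr_opp.
have [->|ba] := eqVneq b a; first by rewrite aNa exprVn invrK.
have [_|bNa] := eqVneq b (- a); first by rewrite exprVn.
have -> : (a + - b \in Phi) = (b - a \in Phi) by rewrite -opprB root_oppE.
have -> : (- b - a \in Phi) = (a + b \in Phi) by rewrite -opprD addrC root_oppE.
case: ifP => h2; case: ifP => h3; rewrite ?invrK ?invr1 //.
by have := sub_notin hPhi hsl aP bP h3; rewrite h2.
Qed.

Lemma acts_h a t : a \in Phi -> t != 0 -> acts (h a t) (hchar a t).
Proof.
move=> aP t0 b bP; split; last 1 first.
- move=> u; rewrite /hchar.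
  have [->|ba] := eqVneq b a; first exact: hJ_self.
  have [->|bNa] := eqVneq b (- a); first exact: hJ_opp.
  have [?|nadd] := boolP (a + b \in Phi); first exact: hJ_add.
  have [?|nsub] := boolP (b - a \in Phi); first exact: hJ_sub.
  by rewrite mul1r hJ_orth.
- by rewrite /hchar; do ?[case: ifP => _];
  rewrite ?expf_neq0 ?invr_eq0 ?oner_eq0.
- exact: hchar_opp.
Qed.

(** * Torus relations in the cover and bimultiplicativity of the symbol *)

Lemma acts_w g k b v : acts g k -> b \in Phi -> (w b v ^ g)%g = w b (k b * v).
Proof.
move=> gk bP; have NbP : - b \in Phi by rewrite root_oppE.
have [_ kN kb] := gk _ bP; have [_ _ kNb] := gk _ NbP.
by rewrite /chev_w !conjMg !kb kNb kN invfM mulrN.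
Qed.

(** Conjugation turns w_b(v) w_b(-1) into w_b(kv) w_b(-k) = h_b(kv) h_b(k)^-1, and splitting h_b(kv)
    leaves (v, k). *)
Lemma conj_h g k b v : acts g k -> b \in Phi -> v != 0 ->
  (h b v ^ g)%g = (mu (hilbert v (k b)) * h b v)%g.
Proof.
move=> gk bP v0; have [k0 _ _] := gk _ bP.
rewrite {1}/chev_h conjMg !(acts_w _ gk) // mulrN1 w_ratio // mulrC hM' //.
by rewrite (mulgA (mu _) (h b v)) mulgK.
Qed.

(** Write w^-1 g w as g (g^-1 w^-1 g) w; conjugation by g turns w_b(-1) into w_b(-k), and w_b(-k)
    w_b(1) is known. *)
Lemma conj_w1 g k b : acts g k -> b \in Phi ->
  (g ^ w b 1)%g = (g * (mu (hilbert (k b) (-1)) * h b (k b)))%g.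
Proof.
move=> gk bP; have [k0 _ _] := gk _ bP.
rewrite -w_minus_one // -mulrN1 -(acts_w _ gk) // -wV // !conjgE.
by rewrite !mulgA mulgV mul1g.
Qed.

Lemma root_exists_add : exists a b, [/\ a \in Phi, b \in Phi & a + b \in Phi].
Proof.
have r0 : (0 < r)%N by apply: leq_trans hr.
have aP : tnth Delta (Ordinal r0) \in Phi by apply: (simple_root hDelta);
  apply: mem_tnth.
by have [b [d [bP dP e]]] := root_decomp hPhi hirr hsl hr aP; exists b, d;
  rewrite -e.
Qed.

Lemma hchar_add a b t : a \in Phi -> b \in Phi -> a + b \in Phi -> hchar a t b =
  t.
Proof.
move=> aP bP sP; have [/negbTE ba /negbTE bNa _] :=
  add_root_neq hPhi hsl aP bP sP.
by rewrite /hchar ba bNa sP.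
Qed.

(** For a + b a root, h_a(s) scales x_b by s exactly, so (v, s) measures the commutator of h_b(v)
    and h_a(s). Since h_a(tu) is h_a(t) h_a(u) up to a central sign, it can be conjugated by in two
    steps. *)
Lemma hilbertM v t u : v != 0 -> t != 0 -> u != 0 ->
  hilbert v (t * u) = hilbert v t * hilbert v u.
Proof.
move=> v0 t0 u0; have [a [b [aP bP sP]]] := root_exists_add.
have hJ s : s != 0 -> (h b v ^ h a s)%g = (mu (hilbert v s) * h b v)%g.
  by move=> s0; rewrite (conj_h (acts_h aP s0)) // hchar_add.
apply: mu_hilbert_inj.
  by case: (hilbert_sign v t) => ->; case: (hilbert_sign v u) => ->;
    [left|right|right|left].
rewrite -mu_hilbertM; apply: (mulIg (h b v)).
rewrite -hJ ?mulf_neq0 // -[LHS](conj_mu (hilbert t u)) -hM // conjgM hJ //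
  conjMg hJ //.
rewrite mulgA; congr (_ * _ * _)%g.
by apply/conjg_fixP/commgP; apply: mu_central.
Qed.

(** Two computations of the conjugate of h_b(s) by w_a(1): by [conj_w1], and by reflecting the
    factors w_b into w_{a+b}. The sign [e] comes from the structure constant. *)
Lemma h_add a b s : a \in Phi -> b \in Phi -> a + b \in Phi -> s != 0 ->
  exists e : F, (e = 1 \/ e = -1) /\
    h (a + b) s = (mu (hilbert s e) * (h b s * h a s))%g.
Proof.
move=> aP bP sP s0.
have NaP : - a \in Phi by rewrite root_oppE.
have NbP : - b \in Phi by rewrite root_oppE.
have NsP : - b - a \in Phi by rewrite addrC -opprD root_oppE.
have NsP' : - a - b \in Phi by rewrite -opprD root_oppE.
have baP : b + a \in Phi by rewrite addrC.
have N10 : (-1 : F) != 0 by rewrite oppr_eq0 oner_eq0.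
pose e : F := - (c a b)%:~R.
have e1 : e = 1 \/ e = -1.
  by rewrite /e; case: (chev_c hE aP bP sP) => ->; [right|left; rewrite opprK].
have eV : e^-1 = e by case: e1 => ->; rewrite ?invr1 ?invrN1.
have e0 : e != 0 by case: e1 => ->; rewrite ?oner_eq0.
have wconj v : (w b v ^ w a 1)%g = w (a + b) (e * v).
  rewrite /chev_w !conjMg !(wJ_add _ aP bP sP) ?oner_eq0 // mulr1.
  rewrite (wJ_sub _ aP NbP) ?oner_eq0 // invr1 mulr1.
  rewrite (chev_c_opp hPhi hsl hE aP bP sP) -/e invfM eV mulrN.
  by rewrite -opprD [b + a]addrC.
have := conj_w1 (acts_h bP s0) aP; rewrite hchar_add //.
rewrite {1}/chev_h conjMg !wconj mulrN1 w_ratio // mulrC hM' //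
  (mulgA (mu _) (h (a + b) s)) mulgK.
move=> hh; have {hh} hE1 : h (a + b) s =
    (mu (hilbert s e) * (h b s * (mu (hilbert s (-1)) * h a s)))%g.
  by rewrite -hh mulgA mu_sqr mul1g.
exists (e * -1); split; first by case: e1 => ->; [right|left];
  rewrite ?mul1r ?mulrNN ?mulr1.
rewrite hE1 hilbertM // -mu_hilbertM;
  move: (mu_central (hilbert s (-1)) (h b s)).
move: (mu (hilbert s e)) (mu (hilbert s (-1))) (h b s) (h a s) => m1 m2 p q cm.
by rewrite !mulgA -(mulgA m1 m2) cm !mulgA.
Qed.

(** With b = p + q, apply [h_add] to -p + b = q and to q + (-b) = -p; the factor h_{-p}(s) occurs on
    both sides and cancels. *)
Lemma h_opp b s : b \in Phi -> s != 0 ->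
  exists e : F, (e = 1 \/ e = -1) /\ h (- b) s =
    (mu (hilbert s e) * (h b s)^-1)%g.
Proof.
move=> bP s0; have NbP : - b \in Phi by rewrite root_oppE.
have N10 : (-1 : F) != 0 by rewrite oppr_eq0 oner_eq0.
have [p [q [pP qP ae]]] := root_decomp hPhi hirr hsl hr bP.
have NpP : - p \in Phi by rewrite root_oppE.
have sP : - p + b \in Phi by rewrite ae addKr.
have sE : (- p + b) + (- b) = - p by rewrite addrK.
have [e1 [he1 eq1]] := h_add NpP bP sP s0.
have [|e2 [he2 eq2]] := h_add sP NbP _ s0; first by rewrite sE.
rewrite sE in eq2.
have e10 : e1 != 0 by case: he1 => ->; rewrite ?oner_eq0.
have e20 : e2 != 0 by case: he2 => ->; rewrite ?oner_eq0.
exists (e1 * e2); split.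
  by case: he1 => ->; case: he2 => ->; rewrite ?mul1r ?mulrNN ?mulr1; auto.
rewrite hilbertM // -mu_hilbertM.
move: eq2 (mu_central (hilbert s e1) (h (- b) s)) (mu_sqr (hilbert s e1))
  (mu_sqr (hilbert s e2)).
rewrite eq1; move: (mu _) (mu _) (h b s) (h (- p) s) (h (- b) s) => m1 m2 k z y
  eq2 cm s1 s2.
have {}eq2 : (m2 = m1 * (y * k))%g.
  apply: (mulgI m2); apply: (mulIg z); rewrite s2 mul1g [LHS]eq2.
  by rewrite !mulgA -(mulgA m2 y) -cm !mulgA.
by rewrite eq2 !mulgA s1 mul1g mulgK.
Qed.

(** * The cover of T_0 and its normalization by Weyl elements *)

Local Notation T0t := (torus0_cover Phi abs x pr).
Local Notation TR := (torusR_lift Delta abs xt).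
Local Notation root_h i := (h (tnth Delta i)).

Lemma pr_h a u : a \in Phi -> pr (h a u) = chev_h x a u.
Proof.
move=> aP; have NaP : - a \in Phi by rewrite root_oppE.
by rewrite /chev_h /chev_w !gmulfM !(xt_lift hxt).
Qed.

Lemma T0t_subgroup : is_subgroup T0t.
Proof.
have [T1 TM] := generated_subgroup [set g | exists a u,
    [/\ a \in Phi, U u & g = chev_h x a u]].
by split=> [|g g' Tg Tg']; rewrite /torus0_cover /= ?pr1 // gmulfM prV;
  apply: TM.
Qed.

Lemma T0t_h a u : a \in Phi -> U u -> T0t (h a u).
Proof.
by move=> aP Uu; rewrite /torus0_cover /= pr_h //; apply: mem_generated;
  exists a, u.
Qed.

Lemma T0t_mu z : T0t (mu z).
Proof. by rewrite /torus0_cover /= pr_mu;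
  case: (generated_subgroup [set g | exists a u,
    [/\ a \in Phi, U u & g = chev_h x a u]]). Qed.

(** An element of the cover is determined by its projection up to [eps], so mu_2 and the h_a(u)
    suffice as generators. *)
Lemma T0t_ind (P : set Gt) : is_subgroup P -> (forall z, P (mu z)) ->
  (forall a u, a \in Phi -> U u -> P (h a u)) -> forall g, T0t g -> P g.
Proof.
move=> sP Pmu Ph g Tg.
have Peps g' g'' : pr g' = pr g'' -> P g'' -> P g'.
  move=> /pr_eq[-> //|->] Pg''; apply: (subMg sP) => //.
  by have := Pmu (-1).
have sQ : is_subgroup [set y | exists2 g', P g' & pr g' = y].
  split=> [|y y' [g1 P1 <-] [g2 P2 <-]]; first by exists 1%g;
    [case: sP|apply: pr1].
  by exists (g1 * g2^-1)%g; [apply: sP.2|rewrite gmulfM prV].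
have [|g' Pg' e] := subgroup_gen sQ _ Tg; last exact: Peps (esym e) Pg'.
by move=> _ [a [u [aP Uu ->]]]; exists (h a u); [apply: Ph|apply: pr_h].
Qed.

Lemma acts_mul g g' k k' : acts g k -> acts g' k' ->
  acts (g * g')%g (fun b => k' b * k b).
Proof.
move=> gk gk' b bP; have [k0 kN kb] := gk b bP; have [k0' kN' kb'] := gk' b bP.
split; first exact: mulf_neq0.
  by rewrite kN kN' invfM.
by move=> u; rewrite conjgM kb kb' mulrA.
Qed.

Lemma actsV g k : acts g k -> acts (g^-1)%g (fun b => (k b)^-1).
Proof.
move=> gk b bP; have [k0 kN kb] := gk b bP.
split; [by rewrite invr_eq0|by rewrite kN|move=> u].
by apply: (conjg_inj g); rewrite conjgKV kb mulVKf.
Qed.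

Lemma hchar_unit a t b : U t -> U (hchar a t b).
Proof.
have U1 := units1 hQ2 F; move=> Ut; have Ut' := unitsV Ut.
rewrite /hchar expr2 expr2; do ?[case: ifP => _] => //; exact: (unitsM hQ2).
Qed.

Lemma T0t_acts g : T0t g -> exists2 k, acts g k & forall b, U (k b).
Proof.
move: g; apply: T0t_ind.
- split=> [|g g' [k gk Uk] [k' gk' Uk']].
    exists (fun=> 1) => [b bP|_]; last exact: (units1 hQ2).
    by split; rewrite ?oner_eq0 ?invr1 // => u; rewrite conjg1 mul1r.
  exists (fun b => (k' b)^-1 * k b); first exact: acts_mul (actsV gk').
  by move=> b; apply: (unitsM hQ2); first apply: unitsV.
- move=> z; exists (fun=> 1) => [b bP|_]; last exact: (units1 hQ2).
  split; rewrite ?oner_eq0 ?invr1 // => u.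
  by rewrite mul1r; apply/conjg_fixP/commgP/commute_sym/mu_central.
- move=> a u aP Uu; exists (hchar a u); first by apply: acts_h => //;
  exact: (units_neq0 Uu).
  by move=> b; apply: hchar_unit.
Qed.

Lemma T0t_conj_w a g : a \in Phi -> T0t g -> T0t (g ^ w a 1)%g.
Proof.
move=> aP Tg; have [k gk Uk] := T0t_acts Tg.
rewrite (conj_w1 gk) //; have sT := T0t_subgroup.
apply: (subMg sT) => //; apply: (subMg sT); [exact: T0t_mu|exact: T0t_h].
Qed.

Lemma T0t_conj_wV a g : a \in Phi -> T0t g -> T0t (g ^ (w a 1)^-1)%g.
Proof.
move=> aP Tg; have [k gk Uk] := T0t_acts Tg; have [k0 _ _] := gk a aP.
have -> : (g ^ (w a 1)^-1 = g * h a (k a))%g.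
  rewrite /chev_h -[k a]mulr1 -(acts_w _ gk) // -wV // !conjgE invgK.
  by rewrite !mulgA mulgV mul1g.
by apply: (subMg T0t_subgroup) => //; apply: T0t_h.
Qed.

Lemma pr_h_commute a b u v : a \in Phi -> b \in Phi -> u != 0 -> v != 0 ->
  commute (pr (h a u)) (pr (h b v)).
Proof.
move=> aP bP u0 v0; apply/commgP/conjg_fixP.
have := pr_mu (hilbert u (hchar b v a)); have := conj_h (acts_h bP v0) aP u0.
move: (mu _) (h a u) (h b v) => m p q; rewrite !conjgE => e m1.
have := congr1 pr e.
by rewrite (gmulfM m) (gmulfM _ (p * q)%g) (gmulfM p) m1 mul1g prV.
Qed.

Lemma pr_hM a t u : a \in Phi -> t != 0 -> u != 0 ->
  (pr (h a t) * pr (h a u))%g = pr (h a (t * u)).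
Proof. by move=> aP t0 u0;
  rewrite -gmulfM hM // (gmulfM (mu _)) pr_mu mul1g. Qed.

Lemma hilbert_rad s v : rad s -> U v -> hilbert s v = 1.
Proof. by case=> _; apply. Qed.

Lemma rad_central b v g : b \in Phi -> rad v -> T0t g -> commute (h b v) g.
Proof.
move=> bP Rv /T0t_acts[k gk Uk]; apply/commgP/conjg_fixP.
rewrite (conj_h gk) ?(hilbert_rad Rv) //;
  last by apply/units_neq0/(rad_unit Rv).
by rewrite /mu2 eqxx mul1g.
Qed.

(** * Products over the simple roots, T_R and finite index *)

Section Products.
Variables (K : groupType) (y : 'I_r -> F -> K) (A : F -> Prop).
Hypotheses (A1 : A 1) (AM : forall t u, A t -> A u -> A (t * u)).
Hypothesis AV : forall t, A t -> A t^-1.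
Hypothesis A0 : forall t, A t -> t != 0.
Hypothesis yM : forall i t u, A t -> A u -> (y i t * y i u)%g = y i (t * u).
Hypothesis yC : forall i j t u, A t -> A u -> commute (y i t) (y j u).
(** Applied in Gt to the elements of R, which gives T_R, and in G to all units, whose h_i commute in
    G but only up to sign in Gt. *)
Definition prods : set K :=
  [set g | exists2 a : 'I_r -> F, forall i, A (a i) & g =
    (\prod_i y i (a i))%g].

Let y1 i : y i 1 = 1%g.
Proof. by apply: (mulgI (y i 1)); rewrite yM // mulr1 mulg1. Qed.

Lemma prodsM (a b : 'I_r -> F) : (forall i, A (a i)) -> (forall i, A (b i)) ->
  (\prod_i y i (a i) * \prod_i y i (b i))%g = (\prod_i y i (a i * b i))%g.
Proof.
move=> Aa Ab; rewrite -prodgM_commute; last by move=> i j _ _; apply: yC.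
by apply: eq_bigr => i _; rewrite yM.
Qed.

Lemma prods_subgroup : is_subgroup prods.
Proof.
split=> [|_ _ [a Aa ->] [b Ab ->]].
  by exists (fun=> 1) => //; rewrite big1.
exists (fun i => a i * (b i)^-1) => [i|]; first by apply: AM => //; apply: AV.
apply: (mulIg (\prod_i y i (b i))%g); rewrite mulgVK prodsM => [| i|//].
  by apply: eq_bigr => i _; rewrite mulfVK // A0.
by apply: AM => //; apply: AV.
Qed.

Lemma mem_prods i t : A t -> prods (y i t).
Proof.
move=> At; exists (fun j => if j == i then t else 1) => [j|];
  first by case: ifP.
rewrite (eq_bigr (fun j => if j == i then y j t else 1%g)) => [|j _].
  by rewrite -big_mkcond big_pred1_eq.
by case: ifP.
Qed.

End Products.

Lemma simple_in i : tnth Delta i \in Phi.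
Proof. by apply: (simple_root hDelta); apply: mem_tnth. Qed.

Lemma rad_neq0 s : rad s -> s != 0.
Proof. by move=> /rad_unit/units_neq0. Qed.

Lemma rad_h_commute a b s t : a \in Phi -> b \in Phi -> rad s -> U t ->
  commute (h a s) (h b t).
Proof. by move=> aP bP Rs Ut; apply: rad_central => //; apply: T0t_h. Qed.

Lemma rad_hM a s t : a \in Phi -> rad s -> U t -> (h a s * h a t)%g =
  h a (s * t).
Proof.
move=> aP Rs Ut; rewrite hM ?(units_neq0 Ut) ?(rad_neq0 Rs) //.
by rewrite (hilbert_rad Rs Ut) /mu2 eqxx mul1g.
Qed.

Lemma TR_subgroup : is_subgroup TR.
Proof.
apply: (prods_subgroup (y := fun i => h (tnth Delta i)) (A := rad)).
- exact: (rad1 hQ2 hilbertM).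
- exact: (radM hQ2 hilbertM).
- exact: (radV hilbertM).
- exact: rad_neq0.
- by move=> i t u Rt /rad_unit Uu; apply: rad_hM => //; apply: simple_in.
- by move=> i j t u Rt /rad_unit Uu; apply: rad_h_commute => //;
  apply: simple_in.
Qed.

Lemma TR_simple i s : rad s -> TR (root_h i s).
Proof.
apply: (mem_prods (y := fun i => h (tnth Delta i))).
- exact: (rad1 hQ2 hilbertM).
- by move=> j t u Rt /rad_unit Uu; apply: rad_hM => //; apply: simple_in.
Qed.

Lemma sign_unit e : e = 1 \/ e = -1 -> U e.
Proof. by move=> -[] ->; [|apply: (unitsN hQ2)]; apply: (units1 hQ2). Qed.

(** For s in R the signs (s, 1) and (s, -1) of [h_add] and [h_opp] are trivial, so simple roots
    generate. The Gauss sum of an arbitrary root a needs h_a(s) in T_R, while T_R is defined by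
    simple roots. *)
Lemma rad_h_in (H : set Gt) : is_subgroup H ->
    (forall i s, rad s -> H (root_h i s)) ->
  forall a s, a \in Phi -> rad s -> H (h a s).
Proof.
move=> sH Hs a s aP Rs; have s0 := rad_neq0 Rs.
move: a aP; apply: (root_ind hPhi hsl hDelta) => [i|b bP Hb|b d bP dP sP Hb Hd].
- exact: Hs.
- have [e [/sign_unit e1 ->]] := h_opp bP s0.
  by rewrite (hilbert_rad Rs) // {1}/mu2 eqxx mul1g; apply: subVg.
- have [e [/sign_unit e1 ->]] := h_add bP dP sP s0.
  by rewrite (hilbert_rad Rs) // {1}/mu2 eqxx mul1g; apply: subMg.
Qed.

Lemma TR_h a s : a \in Phi -> rad s -> TR (h a s).
Proof. exact: (rad_h_in TR_subgroup TR_simple). Qed.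

Lemma TR_central m g : TR m -> T0t g -> commute m g.
Proof.
move=> [a Ra ->] Tg; apply/commute_sym/commute_prod => i _; apply/commute_sym.
by apply: rad_central => //; apply: simple_in.
Qed.

(** Root induction again; here the signs of [h_add] and [h_opp] are killed by the projection. *)
Lemma T0t_form g : T0t g -> exists2 a : 'I_r -> F, forall i, U (a i) &
  pr g = (\prod_i pr (root_h i (a i)))%g.
Proof.
pose S := prods (fun i t => pr (root_h i t)) U.
have yM i t u : U t -> U u -> (pr (root_h i t) * pr (root_h i u))%g =
  pr (root_h i (t * u)).
  by move=> Ut Uu; rewrite pr_hM ?simple_in ?(units_neq0 Ut) ?(units_neq0 Uu).
have yC i j t u : U t -> U u -> commute (pr (root_h i t)) (pr (root_h j u)).
  by move=> Ut Uu; apply: pr_h_commute;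
    rewrite ?simple_in ?(units_neq0 Ut) ?(units_neq0 Uu).
have U1 := units1 hQ2 F.
have sS : is_subgroup S.
  by apply: prods_subgroup => //;
    [apply: (unitsM hQ2)|apply: unitsV|apply: units_neq0].
move: g; apply: (T0t_ind (P := fun g => S (pr g))) => [|z|a u aP Uu].
- split=> [|g g' Sg Sg']; first by rewrite pr1; case: sS.
  by rewrite gmulfM prV; apply: sS.2.
- by rewrite pr_mu; case: sS.
have u0 := units_neq0 Uu.
move: a aP; apply: (root_ind hPhi hsl hDelta) => [i|b bP Sb|b d bP dP sP Sb Sd].
- exact: (mem_prods U1 yM).
- have [e [_ ->]] := h_opp bP u0.
  by rewrite (gmulfM (mu _)) pr_mu mul1g prV; apply: subVg.
- have [e [_ ->]] := h_add bP dP sP u0.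
  by rewrite (gmulfM (mu _)) pr_mu mul1g (gmulfM (h d u)); apply: subMg.
Qed.

Variables (N : nat) (t : 'I_N -> F).
Hypothesis Ut : forall i, U (t i).
Hypothesis cover_t : forall u, U u -> exists i, rad (u * (t i)^-1).

(** This is the finite index of mu_2 T_R: the functions [f] are finitely many labels. *)
Lemma T0t_cover g : T0t g -> exists f : {ffun 'I_r -> 'I_N}, exists2 m, TR m &
  exists z, g = (mu z * (m * \prod_i root_h i (t (f i))))%g.
Proof.
move=> /T0t_form[a Ua prg].
have /choice[f hf] : forall i, exists j, rad (a i * (t j)^-1).
  by move=> i; apply: cover_t.
exists (finfun f), (\prod_i root_h i (a i * (t (f i))^-1))%g.
  by exists (fun i => a i * (t (f i))^-1).
have : pr g = pr (\prod_i root_h i (a i * (t (f i))^-1) *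
    \prod_i root_h i (t (finfun f i)))%g.
  rewrite prg -prodgM_commute => [|i j _ _]; last first.
    by apply: rad_h_commute; rewrite ?simple_in.
  rewrite (big_morph pr gmulfM pr1); apply: eq_bigr => i _.
  by rewrite ffunE rad_hM ?simple_in // divfK //; apply: (units_neq0 (Ut _)).
move=> /pr_eq[->|->]; first by exists 1; rewrite /mu2 eqxx mul1g.
by exists (-1).
Qed.

Hypothesis t_distinct : forall i j, rad (t i * (t j)^-1) -> i = j.

Lemma sum_transversal (W : nmodType) (f : F -> W) k : U k ->
    (forall s u, rad s -> U u -> f (s * u) = f u) ->
  \sum_i f (t i * k) = \sum_i f (t i).
Proof.
move=> Uk fR; have k0 := units_neq0 Uk.
have /choice[p hp] : forall i, exists j, rad (t i * k * (t j)^-1).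
  by move=> i; apply: cover_t; apply: (unitsM hQ2).
have p_inj : injective p.
  move=> i j pij; apply: t_distinct.
  have := radM hQ2 hilbertM (hp i) (radV hilbertM (hp j)); rewrite pij.
  suff -> : t i * k / t (p j) * (t j * k / t (p j))^-1 = t i / t j by [].
  by field; rewrite k0 !(units_neq0 (Ut _)).
rewrite [RHS](reindex_inj p_inj); apply: eq_bigr => i _.
by have <- := fR _ _ (hp i) (Ut (p i)); rewrite divfK // (units_neq0 (Ut _)).
Qed.

Lemma linear_ext (K : pzRingType) (V W : lmodType K) (f : V -> W) : linear f ->
  exists g : {linear V -> W}, g =1 f.
Proof.
move=> fl; pose m := GRing.isLinear.Build _ _ _ _ f fl.
by exists (HB.pack f m : {linear V -> W}).
Qed.

(** * Invariance: the Gauss sum as intertwiner *)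

Section Invariance.
Variables (V : lmodType R[i]) (tau : Gt -> {linear V -> V}).
Hypothesis hps : pseudo_spherical T0t TR eps tau.
Local Notation sgn t u := ((hilbert (t : F) (u : F))%:~R : R[i]).

Lemma tauM g g' (v : V) : T0t g -> T0t g' -> tau (g * g')%g v =
  tau g (tau g' v).
Proof. by move=> Tg Tg'; apply: (ps_rep hps).2. Qed.

Lemma tau_mu p u (v : V) : tau (mu (hilbert p u)) v = sgn p u *: v.
Proof.
case: (hilbert_sign p u) => ->; rewrite /mu2 /=.
  by rewrite scale1r (ps_rep hps).1.
by rewrite scaleN1r (ps_genuine hps).
Qed.

Lemma sgnC p u : sgn p u = sgn u p.
Proof. by rewrite hilbertC. Qed.

Lemma sgnM p u s : p != 0 -> u != 0 -> s != 0 -> sgn p (u * s) =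
  sgn p u * sgn p s.
Proof. by move=> p0 u0 s0; rewrite hilbertM // intrM. Qed.

Lemma sgn_sqr p u : sgn p u * sgn p u = 1.
Proof. by rewrite -intrM (hilbert_sqr p u). Qed.

Section OneReflection.
Variable a : root.
Hypothesis aP : a \in Phi.
Local Notation q u := (tau (h a u)).

Lemma qM p u (v : V) : U p -> U u -> q p (q u v) = sgn p u *: q (p * u) v.
Proof.
move=> Up Uu; have Tp := T0t_h aP Up; have Tu := T0t_h aP Uu;
  rewrite -tauM // hM ?(units_neq0 Up) ?(units_neq0 Uu) //.
by rewrite tauM ?tau_mu //;
  [apply: T0t_mu|apply: T0t_h => //; apply: (unitsM hQ2)].
Qed.

Lemma q_rad s u (v : V) : rad s -> U u -> q (s * u) v = q u v.
Proof.
move=> Rs Uu; rewrite -rad_hM // tauM; last exact: T0t_h.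
  by apply: (ps_trivial hps); apply: TR_h.
by apply: T0t_h => //; apply: (rad_unit Rs).
Qed.

Lemma q_tau g k u (v : V) : T0t g -> acts g k -> U u ->
  q u (tau g v) = sgn u (k a) *: tau g (q u v).
Proof.
move=> Tg gk Uu; have Th := T0t_h aP Uu; rewrite -tauM // conjgC.
rewrite (conj_h gk) ?(units_neq0 Uu) // tauM //; last first.
  by apply: (subMg T0t_subgroup) => //; apply: T0t_mu.
by rewrite tauM // ?tau_mu ?linearZ //; apply: T0t_mu.
Qed.

Lemma tau_conj_w g k (v : V) : T0t g -> acts g k -> U (k a) ->
  tau (g ^ w a 1)%g v = sgn (k a) (-1) *: tau g (q (k a) v).
Proof.
move=> Tg gk Uk; have Th := T0t_h aP Uk.
rewrite (conj_w1 gk) // tauM //; last first.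
  by apply: (subMg T0t_subgroup) => //; apply: T0t_mu.
by rewrite tauM // ?tau_mu ?linearZ //; apply: T0t_mu.
Qed.

Definition gauss (v : V) := \sum_i q (t i) v.

Lemma gauss_linear : linear gauss.
Proof.
move=> z u v; rewrite scaler_sumr -big_split; apply: eq_bigr => i _.
by rewrite linearP.
Qed.

Lemma q_gauss k (v : V) : U k ->
  q k (gauss v) = sgn k k *: \sum_i sgn (t i) k *: q (t i) v.
Proof.
move=> Uk; have k0 := units_neq0 Uk; rewrite linear_sum scaler_sumr.
(* The summand takes the value (t_i, k) q(t_i k) v at t_i k: the symbol (t_i k, k) equals (t_i, k)
   (k, k), and (k, k) squares to 1. *)
rewrite -[RHS](sum_transversal (f := fun u => sgn k k *: (sgn u k *: q u v))
  Uk).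
  apply: eq_bigr => i _; rewrite qM // mulrC scalerA; congr (_ *: _).
  have ti0 := units_neq0 (Ut i).
  by rewrite [sgn (t i * k) k]sgnC sgnM // mulrCA sgn_sqr mulr1.
move=> s u Rs Uu; have u0 := units_neq0 Uu; have s0 := rad_neq0 Rs.
rewrite q_rad // [sgn (s * u) k]sgnC sgnM // [sgn k s]sgnC (hilbert_rad Rs) //
  mul1r.
by rewrite sgnC.
Qed.

(** The sign (k, -1) from the conjugation and (k, k) from [q_gauss] cancel by [hilbert_diag]; the
    remaining (t_i, k) are those produced when q(t_i) passes tau(g). *)
Lemma gauss_intertwines g (v : V) : T0t g -> tau (g ^ w a 1)%g (gauss v) =
  gauss (tau g v).
Proof.
move=> Tg; have [k gk Uk] := T0t_acts Tg; have k0 := units_neq0 (Uk a).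
rewrite (tau_conj_w _ Tg gk (Uk a)) q_gauss // linearZ scalerA
  (hilbert_diag hilbertM k0).
rewrite sgn_sqr scale1r linear_sum; apply: eq_bigr => i _.
by rewrite (q_tau _ Tg gk) // linearZ.
Qed.

(** Orthogonality of characters: outside R some unit k has (k, u) = -1, and translation by k changes
    the sign of the sum. *)
Lemma sum_sgn u : U u -> \sum_i sgn (t i) u = if `[< rad u >] then N%:R else 0.
Proof.
move=> Uu; have u0 := units_neq0 Uu; case: asboolP => [Ru|nRu].
  rewrite (eq_bigr (fun=> 1)) => [|i _]; last by rewrite sgnC (hilbert_rad Ru).
  by rewrite sumr_const card_ord.
have [k Uk hk] : exists2 k, U k & hilbert k u = -1.
  apply: contrapT => h; apply: nRu; split=> // k Uk; rewrite hilbertC.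
  by case: (hilbert_sign k u) => // e; case: h; exists k.
have k0 := units_neq0 Uk.
have := sum_transversal (f := fun y => sgn y u) Uk.
rewrite (eq_bigr (fun i => - sgn (t i) u)) => [|i _]; last first.
  by rewrite ![sgn _ u]sgnC sgnM ?(units_neq0 (Ut _)) // [sgn u k]sgnC hk
    mulrN1.
rewrite sumrN => h; apply/eqP; rewrite -eqNr; apply/eqP; apply: h => s y Rs Uy;
  have y0 := units_neq0 Uy; have s0 := rad_neq0 Rs.
by rewrite ![sgn _ u]sgnC sgnM // [sgn u s]sgnC (hilbert_rad Rs) // mul1r.
Qed.

Let N1U : U (-1). Proof. by apply: sign_unit; right. Qed.

(** The coefficient of q(t_i) is the sum over j of (t_j, t_j) (t_i, t_j) = (t_j, - t_i); it vanishes
    unless - t_i is in R, that is, unless t_i represents the class of -1. *)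
Lemma gauss_gauss (v : V) : gauss (gauss v) = N%:R *: q (-1) v.
Proof.
have [i0 hi0] := cover_t N1U; have N10 := units_neq0 N1U.
have -> : gauss (gauss v) = \sum_i (\sum_j sgn (t j) (- t i)) *: q (t i) v.
  rewrite {1}/gauss; under eq_bigr => j _ do rewrite q_gauss // scaler_sumr.
  rewrite exchange_big; apply: eq_bigr => i _; rewrite scaler_suml.
  apply: eq_bigr => j _; rewrite scalerA
    (hilbert_diag hilbertM (units_neq0 (Ut j))).
  rewrite [sgn (t i) _]sgnC -sgnM ?(units_neq0 (Ut _)) //.
  by rewrite mulN1r.
have radi i : rad (- t i) -> rad (-1 * (t i)^-1).
  by move=> /(radV hilbertM); rewrite invrN mulN1r.
have Ri0 : rad (- t i0).
  by have := radV hilbertM hi0; rewrite mulN1r invrN invrK.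
rewrite (bigD1 i0) //= [X in _ + X]big1 ?addr0 => [|i ii0].
  rewrite sum_sgn ?asboolT //; last exact: (rad_unit Ri0).
  by congr (_ *: _); have := q_rad v Ri0 N1U; rewrite mulrN1 opprK.
rewrite sum_sgn; last by apply: (unitsN hQ2).
rewrite asboolF ?scale0r // => Ri; case/eqP: ii0; apply: t_distinct.
have := radM hQ2 hilbertM Ri (radV hilbertM Ri0).
by rewrite invrN mulrNN.
Qed.

Lemma w_invariant : exists phi psi : {linear V -> V},
  [/\ cancel phi psi, cancel psi phi &
     forall g (v : V), T0t g -> psi (tau (g ^ w a 1)%g v) = tau g (psi v)].
Proof.
have N10 := units_neq0 N1U; have U1 := units1 hQ2 F.
have N0 : (N%:R : R[i]) != 0.
  rewrite pnatr_eq0 -lt0n; have [i _] := cover_t U1.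
  by apply: leq_ltn_trans (ltn_ord i).
(* As phi commutes with q(-1), phi^2 = N q(-1) and q(-1)^2 = (-1, -1), the inverse of phi is e phi
   q(-1). *)
pose e := sgn (-1) (-1) / N%:R.
have qq (v : V) : q (-1) (q (-1) v) = sgn (-1) (-1) *: v.
  by rewrite qM // mulrNN mulr1 h1 // (ps_rep hps).1.
have gauss_q (v : V) : gauss (q (-1) v) = q (-1) (gauss v).
  rewrite /gauss linear_sum; apply: eq_bigr => i _.
  by rewrite !qM // hilbertC mulrC.
have gZ z (v : V) : gauss (z *: v) = z *: gauss v.
  by rewrite /gauss scaler_sumr; apply: eq_bigr => i _; apply: linearZ.
pose inv (v : V) := e *: gauss (q (-1) v).
have inv_lin : linear inv.
  by move=> z u v; rewrite /inv linearP gauss_linear scalerDr !scalerA mulrC.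
have ee (v : V) : e *: (N%:R *: (sgn (-1) (-1) *: v)) = v.
  by rewrite !scalerA /e divfK // sgn_sqr scale1r.
have gK : cancel gauss inv by move=> v; rewrite /inv -gauss_q gauss_gauss qq ee.
have invK : cancel inv gauss by move=> v; rewrite /inv gZ gauss_gauss qq ee.
have [phi hphi] := linear_ext gauss_linear;
  have [psi hpsi] := linear_ext inv_lin.
exists phi, psi; split=> [v|v|g v Tg].
- by rewrite hphi hpsi.
- by rewrite hphi hpsi.
- by rewrite hpsi -{1}[v]invK gauss_intertwines // gK hpsi.
Qed.

End OneReflection.

Lemma weyl_invariant (om : Gt) : weyl_lift Phi xt om ->
  isomorphic_rep T0t (conj_rep om tau) tau.
Proof.
(* Stability of the torus under g and under g^-1 is recorded together so that [S] is closed under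
   quotients; [psi] is the intertwiner and [phi] its inverse. *)
move=> hom; pose S : set Gt := fun g => [/\ forall y, T0t y -> T0t (y ^ g)%g,
  forall y, T0t y -> T0t (y ^ g^-1)%g &
  exists phi psi : {linear V -> V}, [/\ cancel phi psi, cancel psi phi &
     forall y (v : V), T0t y -> psi (tau (y ^ g)%g v) = tau y (psi v)]].
have sS : is_subgroup S.
  split=> [|g g' [Tg TgV [f1 [p1 [fp1 pf1 h1]]]]
    [Tg' TgV' [f2 [p2 [fp2 pf2 h2]]]]].
    split=> [y|y|]; rewrite ?invg1 ?conjg1 //.
    have idl : linear (id : V -> V) by [].
    have [i hi] := linear_ext idl.
    by exists i, i; split=> [v|v|y v Ty]; rewrite !hi // conjg1.
  split=> [y Ty|y Ty|].
  - by rewrite conjgM; apply: TgV'; apply: Tg.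
  - by rewrite invgF conjgM; apply: TgV; apply: Tg'.
  (* For g g'^-1, the intertwiner of g is composed with the inverse of that of g'. *)
  have l1 : linear (p1 \o f2) by move=> z u v; rewrite /= !linearP.
  have l2 : linear (p2 \o f1) by move=> z u v; rewrite /= !linearP.
  have [k1 hk1] := linear_ext l1; have [k2 hk2] := linear_ext l2.
  exists k2, k1; split=> [v|v|y v Ty].
  - by rewrite hk1 hk2 /= pf2 fp1.
  - by rewrite hk1 hk2 /= pf1 fp2.
  have Tyg := Tg _ Ty.
  rewrite !hk1 /= conjgM -h1 //; congr (p1 _).
  by rewrite -[RHS]pf2 -{2}(conjgKV g' (y ^ g)%g) h2 ?fp2 //; apply: TgV'.
have Sw : S om.
  apply: (subgroup_gen sS) hom => _ [a aP ->]; split=> [y|y|].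
  - exact: T0t_conj_w.
  - exact: T0t_conj_wV.
  - exact: w_invariant.
have [_ _ [f [p [fp pf hp]]]] := Sw.
exists p; first by exists f.
by move=> g Tg v; rewrite /conj_rep -hp // conjgE mulgA.
Qed.

End Invariance.

(** * Existence: faithfulness of the torus and induction *)

Section Matrices.
Variable mat : G -> 'M[F]_n.
Hypotheses (hG : chevalley_group Phi E x mat)
  (hsc : weights_span_lattice Delta E).

Lemma char0_ext k : (k.+1%:R : F) != 0.
Proof. by rewrite (natr_eq0_ext hQ2). Qed.

Lemma mat_chev_w a u : a \in Phi ->
  mat (chev_w x a u) = weyl_mx (E a) (E (- a)) u.
Proof.
move=> aP; have NaP : - a \in Phi by rewrite root_oppE.
by rewrite /chev_w !(matM hG) !(mat_x hG).
Qed.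

(** w_a(-1) sends v to a vector of weight - m, on which w_a(u) is u ^ m w_a(1); and w_a(1) w_a(-1) =
    1. *)
Lemma mat_h a u (m : int) (v : 'cV[F]_n) : a \in Phi -> u != 0 ->
  coroot_mx E a *m v = m%:~R *: v -> mat (chev_h x a u) *m v = u ^ m *: v.
Proof.
move=> aP u0 Hv; have NaP : - a \in Phi by rewrite root_oppE.
have N10 : (-1 : F) != 0 by rewrite oppr_eq0 oner_eq0.
have XY : E a *m E (- a) = E (- a) *m E a + coroot_mx E a.
  by rewrite /coroot_mx /mxbracket addrC subrK.
have br_swap (A B C : 'M[F]_n) z : mxbracket A B = z *: C -> A *m B =
  B *m A + z *: C.
  by move=> <-; rewrite /mxbracket addrC subrK.
have HX : coroot_mx E a *m E a = E a *m coroot_mx E a + 2 *: E a.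
  by apply/br_swap/(@chev_coroot _ _ _ _ _ _ _ hE a a 2) => //;
    rewrite (cartan_diag hPhi).
have HY : coroot_mx E a *m E (- a) = E (- a) *m coroot_mx E a + (- 2) *:
  E (- a).
  apply/br_swap/(@chev_coroot _ _ _ _ _ _ _ hE a (- a) (- 2)) => //.
  by rewrite cartanNl (cartan_diag hPhi).
have Hv' : coroot_mx E a *m (weyl_mx (E a) (E (- a)) (-1) *m v) =
    (- m)%:~R *: (weyl_mx (E a) (E (- a)) (-1) *m v).
  rewrite mulmxA (weyl_mx_anti char0_ext XY HX HY) // mulNmx -mulmxA Hv.
  by rewrite -scalemxAr mulrNz scaleNr.
rewrite /chev_h (matM hG) !mat_chev_w // -mulmxA.
rewrite (weyl_mx_weight char0_ext XY HX HY u0 Hv') opprK; congr (_ *: _).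
rewrite mulmxA -!mat_chev_w // -(matM hG).
have -> : (chev_w x a 1 * chev_w x a (-1))%g = 1%g.
  by rewrite -[LHS]/(chev_h x a 1) -pr_h // h1 // pr1.
by rewrite (mat1 hG) mul1mx.
Qed.

(** The product acts on a vector of weight m by [chi m], so the kernel of [chi] contains all
    weights, hence the whole lattice; each fundamental weight then gives a_i = 1. *)
Lemma torus_inj (a : 'I_r -> F) : (forall i, a i != 0) ->
  (\prod_i pr (root_h i (a i)))%g = 1%g -> forall i, a i = 1.
Proof.
move=> a0 prod1.
pose chi (m : 'rV[int]_r) := \prod_i a i ^ m 0 i.
pose L : {pred 'rV[int]_r} := [pred m | chi m == 1].
have Lz : zmod_closed L.
  split=> [|m1 m2]; rewrite !inE /chi.
    by apply/eqP; apply: big1 => i _; rewrite mxE.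
  move=> /eqP h1' /eqP h2'; apply/eqP; transitivity (chi m1 / chi m2);
    last first.
    by rewrite /chi h1' h2' divr1.
  rewrite /chi -prodf_div; apply: eq_bigr => i _.
  by rewrite !mxE expfzDr // invr_expz.
have Lw m : weight Delta E m -> m \in L.
  move=> [v v0 Hv]; rewrite inE.
  have act (s : seq 'I_r) : mat (\prod_(i <- s) pr (root_h i (a i)))%g *m v =
      (\prod_(i <- s) a i ^ m 0 i) *: v.
    elim: s => [|i s ih]; first by rewrite !big_nil (mat1 hG) mul1mx scale1r.
    rewrite !big_cons (matM hG) -mulmxA ih -scalemxAr pr_h ?simple_in //.
    by rewrite (mat_h _ _ (Hv i)) ?simple_in // scalerA mulrC.
  have := act (index_enum 'I_r);
    rewrite prod1 (mat1 hG) mul1mx -/(chi m) => /eqP.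
  rewrite -[X in X == _]scale1r -subr_eq0 -scalerBl scaler_eq0 (negbTE v0) orbF.
  by rewrite subr_eq0 eq_sym.
move=> i; have := hsc Lz Lw (delta_mx 0 i); rewrite inE /chi (bigD1 i) //=.
rewrite mxE !eqxx expr1z big1 ?mulr1 => [/eqP //|j ji].
by rewrite mxE (negbTE ji) andbF expr0z.
Qed.

Lemma eps_notin_TR : ~ TR eps.
Proof.
move=> [a Ra epsE]; have a0 i := rad_neq0 (Ra i).
have a1 : forall i, a i = 1.
  apply: torus_inj => //; rewrite -(big_morph pr gmulfM pr1).
  by have := congr1 pr epsE; rewrite pr_eps => <-.
have := cover_eps hGt; rewrite epsE big1 ?eqxx // => i _.
by rewrite a1 h1 // simple_in.
Qed.

Definition TRpm : set Gt := fun g => TR g \/ TR (eps * g)%g.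

Lemma eps_comm g : (g * eps = eps * g)%g.
Proof. exact/esym/(cover_central hGt). Qed.

Lemma TRpm_subgroup : is_subgroup TRpm.
Proof.
have sT := TR_subgroup; split=> [|g g']; first by left; apply: sub1g.
have e g1 g2 : (eps * (g1 * g2^-1) = (eps * g1) * g2^-1)%g by rewrite mulgA.
have eV g2 : ((eps * g2)^-1 = g2^-1 * eps)%g.
  by rewrite invgM; congr (_ * _)%g; apply: mulg1_eq; apply: eps_eps.
move=> [Tg|Tg] [Tg'|Tg'].
- by left; apply: sT.2.
- right; rewrite e -[(eps * g)%g]eps_comm -mulgA -[(eps * g'^-1)%g]eps_comm -eV.
  exact: sT.2.
- by right; rewrite e; apply: sT.2.
- left; have := sT.2 _ _ Tg Tg'; rewrite eV mulgA -[(_ * eps)%g]mulgA.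
  by rewrite -!mulgA [(g'^-1 * eps)%g]eps_comm !mulgA
    [(eps * g * eps)%g]eps_comm !mulgA eps_eps mul1g.
Qed.

(** The genuine character of mu_2 T_R trivial on T_R, extended by 0 as in the matrix coefficients of
    an induced representation. The first two cases exclude each other by [eps_notin_TR]. *)
Definition chi g : R[i] := if `[< TR g >] then 1 else if `[< TR (eps * g)%g >]
  then -1 else 0.

Lemma chi_eps g : chi (eps * g)%g = - chi g.
Proof.
rewrite /chi mulgA eps_eps mul1g.
case: asboolP => [h1'|h1']; case: asboolP => [h2'|h2'];
  rewrite ?opprK ?oppr0 //.
case: eps_notin_TR; have := TR_subgroup.2 _ _ h1' h2'.
by rewrite -mulgA mulgV mulg1.
Qed.

Lemma chi_TR m g : TR m -> chi (m * g)%g = chi g.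
Proof.
move=> Tm; have sT := TR_subgroup.
have e g' : TR (m * g')%g <-> TR g'.
  split=> [h'|]; last exact: (subMg sT).
  by rewrite -[g'](mulKg m); apply: (subMg sT) => //; apply: subVg.
rewrite /chi (asbool_equiv_eq (e g)).
have -> : (eps * (m * g) = m * (eps * g))%g by rewrite !mulgA -(eps_comm m).
by rewrite (asbool_equiv_eq (e _)).
Qed.

Lemma chi_neq0 g : chi g != 0 <-> TRpm g.
Proof.
rewrite /chi /TRpm; case: asboolP => h1'; first by rewrite oner_eq0;
  split=> // _; left.
case: asboolP => h2'; first by rewrite oppr_eq0 oner_eq0; split=> // _; right.
by rewrite eqxx; split=> // -[].
Qed.

Lemma chi1 : chi 1%g = 1.
Proof. by rewrite /chi asboolT //; apply: sub1g TR_subgroup. Qed.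

(** It is enough that g lies in the support: for g' outside it, so is g g', and both sides
    vanish. *)
Lemma chiM g g' : chi g != 0 -> chi (g * g')%g = chi g * chi g'.
Proof.
move=> /chi_neq0[Tg|Tg].
  by rewrite chi_TR // -[g in RHS]mulg1 chi_TR // chi1 mul1r.
have ge : g = (eps * (eps * g))%g by rewrite mulgA eps_eps mul1g.
have -> : chi g = -1 by rewrite {1}ge chi_eps -[(eps * g)%g]mulg1 chi_TR //
  chi1.
by rewrite {1}ge -(mulgA eps) chi_eps chi_TR // mulN1r.
Qed.

Lemma pseudo_spherical_exists :
  exists (V : lmodType R[i]) (tau : Gt -> {linear V -> V}),
  pseudo_spherical T0t TR eps tau.
Proof.
have sP := TRpm_subgroup; have sT := T0t_subgroup.
have chiV g : chi g != 0 -> chi g^-1%g != 0 by move=> /chi_neq0 h';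
  apply/chi_neq0/(subVg sP).
have chiMn g g' : chi g != 0 -> chi g' != 0 -> chi (g * g')%g != 0.
  by move=> /chi_neq0 h' /chi_neq0 h''; apply/chi_neq0/(subMg sP).
pose l (f : {ffun 'I_r -> 'I_N}) := (\prod_i root_h i (t (f i)))%g.
have [|y|y z f Ty Tz yf zf|K [b [Tb b_distinct b_cover]]] :=
  @finite_transversal Gt _ T0t (fun y z => chi (y * z^-1)%g != 0)
    (enum {ffun 'I_r -> 'I_N}) (fun y f => chi (y * (l f)^-1)%g != 0).
- by move=> y z /chiV; rewrite invgF.
- move=> /T0t_cover[f [m Tm [z ye]]].
  have fi : (index f (enum {ffun 'I_r -> 'I_N}) < size
    (enum {ffun 'I_r -> 'I_N}))%N.
    by rewrite index_mem mem_enum.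
  exists (Ordinal fi) => s0; rewrite nth_index ?mem_enum //.
  rewrite ye -/(l f) mulgA mulgK /mu2; case: ifP => _.
    by rewrite mul1g -[m]mulg1 chi_TR // chi1 oner_eq0.
  by rewrite chi_eps -[m]mulg1 chi_TR // chi1 oppr_eq0 oner_eq0.
- by have := chiMn _ _ yf (chiV _ zf); rewrite invgF divgKA.
have chib i j : chi (b i * (b j)^-1)%g = (i == j)%:R.
  have [->|ij] := eqVneq i j; first by rewrite mulgV chi1.
  by apply/eqP; apply: contra_neqT ij => /b_distinct.
(* The representation induced from [chi], in the basis given by the cosets of the b_i, transposed to
   act on row vectors. *)
pose D g : 'M[R[i]]_K := \matrix_(i, j) chi (b j * g * (b i)^-1)%g.
have K0 : (0 < K)%N.
  by have [i _] := b_cover _ (sub1g sT); apply: leq_ltn_trans (ltn_ord i).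
have D1 : D 1%g = 1%:M by apply/matrixP => i j; rewrite !mxE mulg1 chib eq_sym.
have DM g g' : T0t g -> T0t g' -> D (g * g')%g = D g' *m D g.
  move=> Tg Tg'; apply/matrixP => i k; rewrite !mxE.
  (* Only the coset of b_k g contributes to the matrix product: on any other b_j' the factor [chi]
     is 0. *)
  have [j hj] := b_cover _ (subMg sT (Tb k) Tg).
  rewrite (bigD1 j) //= big1 ?addr0 => [|j' j'j]; rewrite !mxE.
    rewrite mulrC -chiM //; congr chi; move: (b i) (b j) (b k) => p q s'.
    by rewrite !mulgA mulgVK.
  suff -> : chi (b k * g * (b j')^-1)%g = 0 by rewrite mulr0.
  apply/eqP; apply: contra_neqT j'j => hj'; apply: b_distinct.
  by have := chiMn _ _ (chiV _ hj') hj; rewrite invgF divgKA.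
have Deps : D eps = (-1)%:M.
  apply/matrixP => i j; rewrite !mxE eps_comm -mulgA chi_eps chib eq_sym.
  by case: eqP; rewrite ?oppr0.
have DTR m : TR m -> D m = 1%:M.
  move=> Tm; apply/matrixP => i j; rewrite !mxE -(TR_central Tm (Tb j)) -mulgA.
  by rewrite chi_TR // chib eq_sym.
have [V [tau [rep irr scal]]] := irreducible_constituent K0 D1 DM.
exists V, tau; split=> // [v|m Tm v].
- by rewrite (scal _ _ Deps) scaleN1r.
- by rewrite (scal _ _ (DTR m Tm)) scale1r.
Qed.

End Matrices.
End Cover.

Theorem theorem4p14
  (R : realType)
  (Q2 : fieldType) (abs : Q2 -> R) (hQ2 : padic_completion 2 abs)
  (F : fieldExtType Q2)
  (r : nat) (hr : (2 <= r)%N)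
  (Phi : seq 'rV[R]_r) (hPhi : root_system Phi)
  (hirr : root_irreducible Phi) (hsl : simply_laced Phi)
  (Delta : r.-tuple 'rV[R]_r) (hDelta : simple_roots Phi Delta)
  (n : nat) (c : 'rV[R]_r -> 'rV[R]_r -> int) (E : 'rV[R]_r -> 'M[F]_n)
  (hE : chevalley_basis Phi c E) (hsc : weights_span_lattice Delta E)
  (G : topGroupType) (x : 'rV[R]_r -> F -> G) (mat : G -> 'M[F]_n)
  (hG : chevalley_group Phi E x mat) (htop : dyadic_topology abs mat)
  (Gt : topGroupType) (pr : {multiplicative Gt -> G}) (eps : Gt)
  (hGt : topological_double_cover pr eps) (hnt : nontrivial_extension pr)
  (xt : 'rV[R]_r -> F -> Gt) (hxt : cover_relations Phi c x pr eps xt) :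
  let T0t := torus0_cover Phi abs x pr in
  let TR := torusR_lift Delta abs xt in
  (exists (V : lmodType R[i]) (tau : Gt -> {linear V -> V}),
     pseudo_spherical T0t TR eps tau) /\
  (forall (V : lmodType R[i]) (tau : Gt -> {linear V -> V}),
     pseudo_spherical T0t TR eps tau ->
     forall w : Gt, weyl_lift Phi xt w ->
       isomorphic_rep T0t (conj_rep w tau) tau).
Proof.
move=> T0t TR.
have hilbM := hilbertM hr hPhi hirr hsl hDelta hE hGt hxt.
have [N [t [Ut t_distinct cover_t]]] := unit_rad_transversal hQ2 hilbM.
split.
  exact: (pseudo_spherical_exists hQ2 hr hPhi hirr hsl hDelta hE hGt hxt Ut
    cover_t hG hsc).
move=> V tau hps w Ww.
exact: (weyl_invariant hQ2 hr hPhi hirr hsl hDelta hE hGt hxt Ut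
  cover_t t_distinct hps Ww).
Qed.
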